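(* The satisfiability problem for the EQCAT-CONST fragment of the theory of strings (string terms built only from string variables and string constants; atomic predicates equality $t_1 = t_2$ and containment-at-position $t_1 \sqsupseteq_i t_2$ where $i$ is a constant natural number; formulas built from these atoms using Boolean negation and conjunction) is NP-hard.
   Context: Strings are finite words over a finite alphabet $\Sigma$; $\epsilon$ denotes the empty string. An instance of the satisfiability problem consists of a finite alphabet $\Sigma$, a formula of the fragment, and for each string variable a natural-number bound on its length. Formulas are conjunctions of Boolean expressions, where a Boolean expression is $\mathit{true}$, $\mathit{false}$, the negation of a Boolean expression, or an atomic predicate. The instance is satisfiable iff there is an assignment of strings over $\Sigma$ to the variables, each respecting its length bound, under which the formula evaluates to true. Semantics: $t_1 = t_2$ holds iff both sides denote the same string; $t_1 \sqsupseteq_i t_2$ holds iff the string denoted by $t_2$ occurs as a contiguous substring of the string denoted by $t_1$ starting at position $i$, positions being numbered from $1$ (e.g. $\mathit{bombay} \sqsupseteq_4 \mathit{bay}$ holds). *)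

(* Defs.v *)
From Stdlib Require Import BinNums.
From Stdlib Require BinNat.
From mathcomp Require Import all_boot.

Set Implicit Arguments.
Unset Strict Implicit.
Unset Printing Implicit Defensive.

(* The alphabet of an instance with [sigma] letters is {0, ..., sigma-1};
   strings are sequences of letters (seq nat); variables are named by nats. *)
Inductive sterm : Type :=
  | SVar   of nat
  | SConst of seq nat.

Inductive satom : Type :=
  | AEq   of sterm & sterm
  | ACont of sterm & nat & sterm.

Inductive sbexp : Type :=
  | BTrue
  | BFalse
  | BNot  of sbexp
  | BAtom of satom.

(* A formula is a conjunction of Boolean expressions. *)
Definition sformula := seq sbexp.

(* An instance: alphabet size, formula, and a length bound for every
   string variable (variable v has bound [nth 0 bounds v], v < size bounds). *)
Record instance := Instance {
  inst_sigma   : nat;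
  inst_formula : sformula;
  inst_bounds  : seq nat
}.

Definition wf_term (I : instance) (t : sterm) : bool :=
  match t with
  | SVar v => v < size (inst_bounds I)
  | SConst s => all (fun c => c < inst_sigma I) s
  end.

Definition wf_atom (I : instance) (a : satom) : bool :=
  match a with
  | AEq t1 t2 => wf_term I t1 && wf_term I t2
  | ACont t1 _ t2 => wf_term I t1 && wf_term I t2
  end.

Fixpoint wf_bexp (I : instance) (e : sbexp) : bool :=
  match e with
  | BTrue | BFalse => true
  | BNot e' => wf_bexp I e'
  | BAtom a => wf_atom I a
  end.

Definition wf_instance (I : instance) : bool := all (wf_bexp I) (inst_formula I).

Definition eval_term (asg : nat -> seq nat) (t : sterm) : seq nat :=
  match t with
  | SVar v => asg v
  | SConst s => s
  end.

(* s1 ⊒_i s2 : s2 occurs in s1 starting at position i (positions from 1). *)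
Definition contains_at (s1 : seq nat) (i : nat) (s2 : seq nat) : Prop :=
  0 < i /\ exists u v : seq nat, s1 = u ++ s2 ++ v /\ size u = i.-1.

Definition eval_atom (asg : nat -> seq nat) (a : satom) : Prop :=
  match a with
  | AEq t1 t2 => eval_term asg t1 = eval_term asg t2
  | ACont t1 i t2 => contains_at (eval_term asg t1) i (eval_term asg t2)
  end.

Fixpoint eval_bexp (asg : nat -> seq nat) (e : sbexp) : Prop :=
  match e with
  | BTrue => True
  | BFalse => False
  | BNot e' => ~ eval_bexp asg e'
  | BAtom a => eval_atom asg a
  end.

Definition eval_formula (asg : nat -> seq nat) (f : sformula) : Prop :=
  foldr (fun e P => eval_bexp asg e /\ P) True f.

Definition admissible (I : instance) (asg : nat -> seq nat) : Prop :=
  forall v, v < size (inst_bounds I) ->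
    all (fun c => c < inst_sigma I) (asg v) /\ size (asg v) <= nth 0 (inst_bounds I) v.

Definition satisfiable (I : instance) : Prop :=
  exists asg, admissible I asg /\ eval_formula asg (inst_formula I).

Fixpoint pos_bits (p : positive) : seq bool :=
  match p with
  | xH => [:: true]
  | xO q => false :: pos_bits q
  | xI q => true :: pos_bits q
  end.

(* binary digits of n, least significant first, no leading zeros (0 ↦ [::]) *)
Definition nat_bits (n : nat) : seq bool :=
  match BinNat.N.of_nat n with
  | N0 => [::]
  | Npos p => pos_bits p
  end.

(* self-delimiting code: each bit b as "1 b", terminated by "0 0" *)
Definition enc_nat (n : nat) : seq bool :=
  flatten [seq [:: true; b] | b <- nat_bits n] ++ [:: false; false].

Definition ser_term (t : sterm) : seq nat :=
  match t with
  | SVar v => [:: 0; v]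
  | SConst s => [:: 1, size s & s]
  end.

Definition ser_atom (a : satom) : seq nat :=
  match a with
  | AEq t1 t2 => 0 :: ser_term t1 ++ ser_term t2
  | ACont t1 i t2 => 1 :: ser_term t1 ++ i :: ser_term t2
  end.

Fixpoint ser_bexp (e : sbexp) : seq nat :=
  match e with
  | BTrue => [:: 0]
  | BFalse => [:: 1]
  | BNot e' => 2 :: ser_bexp e'
  | BAtom a => 3 :: ser_atom a
  end.

Definition ser_instance (I : instance) : seq nat :=
  [:: inst_sigma I, size (inst_bounds I) & inst_bounds I]
  ++ size (inst_formula I) :: flatten (map ser_bexp (inst_formula I)).

Definition encode_instance (I : instance) : seq bool :=
  flatten (map enc_nat (ser_instance I)).

Definition EQCAT_CONST_SAT (x : seq bool) : Prop :=
  exists I, wf_instance I /\ encode_instance I = x /\ satisfiable I.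

Unset Implicit Arguments.

Inductive move := MLeft | MRight | MStay.

Record TM := {
  tm_state  : finType;
  tm_sym    : finType;
  tm_blank  : tm_sym;
  tm_in     : bool -> tm_sym;
  tm_out    : tm_sym -> option bool;
  tm_start  : tm_state;
  tm_halt   : pred tm_state;
  tm_accept : pred tm_state;
  tm_delta  : tm_state -> tm_sym -> tm_state * tm_sym * move
}.

(* tape = (cells left of head, reversed; head cell; cells right of head) *)
Definition tape (M : TM) := (seq (tm_sym M) * tm_sym M * seq (tm_sym M))%type.
Definition config (M : TM) := (tm_state M * tape M)%type.

Definition move_tape (M : TM) (m : move) (t : tape M) : tape M :=
  let: (l, a, r) := t in
  match m with
  | MStay => t
  | MLeft => match l with
             | [::] => ([::], tm_blank M, a :: r)
             | b :: l' => (l', b, a :: r)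
             end
  | MRight => match r with
              | [::] => (a :: l, tm_blank M, [::])
              | b :: r' => (a :: l, b, r')
              end
  end.

Definition step (M : TM) (c : config M) : config M :=
  let: (q, (l, a, r)) := c in
  if tm_halt M q then c
  else let: (q', b, m) := tm_delta M q a in (q', move_tape M m (l, b, r)).

Definition init_config (M : TM) (x : seq bool) : config M :=
  (tm_start M,
   match map (tm_in M) x with
   | [::] => ([::], tm_blank M, [::])
   | a :: r => ([::], a, r)
   end).

Definition run (M : TM) (n : nat) (x : seq bool) : config M :=
  iter n (step M) (init_config M x).

Fixpoint read_out (M : TM) (s : seq (tm_sym M)) : seq bool :=
  match s with
  | [::] => [::]
  | a :: s' => match tm_out M a with
               | Some b => b :: read_out M s'
               | None => [::]
               end
  end.

Definition output (M : TM) (c : config M) : seq bool :=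
  let: (_, (_, a, r)) := c in read_out M (a :: r).

Definition pbound (c k n : nat) : nat := c * n.+1 ^ k.

Definition in_P (L : seq bool -> Prop) : Prop :=
  exists (M : TM) (c k : nat), forall x, exists t,
    t <= pbound c k (size x) /\ tm_halt M (run M t x).1 /\
    (tm_accept M (run M t x).1 <-> L x).

Definition poly_computable (f : seq bool -> seq bool) : Prop :=
  exists (M : TM) (c k : nat), forall x, exists t,
    t <= pbound c k (size x) /\ tm_halt M (run M t x).1 /\
    output M (run M t x) = f x.

Definition pair_bits (x w : seq bool) : seq bool :=
  flatten [seq [:: b; b] | b <- x] ++ [:: false; true] ++ w.

Definition in_NP (L : seq bool -> Prop) : Prop :=
  exists (V : seq bool -> Prop) (c k : nat), in_P V /\
    forall x, L x <-> exists w, size w <= pbound c k (size x) /\ V (pair_bits x w).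

Definition NP_hard (L : seq bool -> Prop) : Prop :=
  forall L' : seq bool -> Prop, in_NP L' ->
    exists f, poly_computable f /\ forall x, L' x <-> L (f x).

(* Main.v *)
(* A verifier run is written as one long string cut into rows of length W, one
   row per configuration, the letter under the head also carrying the state.
   With D = W + 1, every window obeys S[p + D] = rule(S[p], S[p+1], S[p+2]); no
   row boundary has to be marked, because the rows are wide enough for the tape
   to be blank around their ends.  The first D letters spell the input of the
   verifier, with a stretch left free for the witness, and rejection is ruled
   out locally by forbidding halted non-accepting letters.  Cell p is the string
   variable 2p and the window at p is the variable 2p + 1, of length at most 4,
   which contains the cells p, p + 1, p + 2 and p + D at its positions 1, 2, 3
   and 4; all that remains are disequalities between one variable and constants.
   The reduction is computed by a loop program on stacks, whose steps a
   one-tape machine simulates in time linear in the heights of the stacks. *)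

Require Import Defs.
From HB Require Import structures.
From mathcomp Require Import all_boot.
From mathcomp Require Import zify.
From Stdlib Require Import BinNums.
From Stdlib Require BinNat.

Set Implicit Arguments.
Unset Strict Implicit.
Unset Printing Implicit Defensive.

(** * Injectivity of the encoding *)

(** A conjunct is a single atom under negations, so no clause can be stated directly. A relation
    between four cells becomes expressible once the cells are packed into one variable: it is then
    the absence of finitely many words of length at most 4. Their number depends on the verifier
    alone, so the lists of words are constants of the program that writes the formula; only variable
    numbers vary. The shift is W + 1 and not W because a window starting at p fixes the letter one
    row below its middle cell p + 1. Letter W lies below cell 0, which is the middle of no window,
    and is therefore prescribed at the end of the first D letters. Windows that straddle two rows
    are harmless when the cells around the cut hold blanks or end markers. This dictates the margin
    B: the head starts in column B, moves at most one column per step and halts within B - 3 steps.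
    The encoding is binary, but all quantities in the formula are polynomial in the input length, so
    the program counts in unary and converts only on output. *)

Lemma pos_bits_inj : injective pos_bits.
Proof.
have nz p : pos_bits p <> [::] by case: p.
elim=> [p IH|p IH|] [q|q|] //=; try (by case=> /IH ->).
- by case=> /nz.
- by case=> /esym /nz.
Qed.

Lemma nat_bits_inj : injective nat_bits.
Proof.
move=> m n; rewrite /nat_bits => E; apply: Nnat.Nat2N.inj; move: E.
have nz p : pos_bits p <> [::] by case: p.
case: (BinNat.N.of_nat m) => [|p]; case: (BinNat.N.of_nat n) => [|q] //=.
- by move/esym/nz.
- by move/nz.
- by move/pos_bits_inj ->.
Qed.

(** This is the recursion executed by the emitting program: output the parity, go on with the
    half. *)
Lemma nat_bits_rec v : 0 < v -> nat_bits v = odd v :: nat_bits v./2.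
Proof.
have dbl n : 0 < n -> nat_bits n.*2 = false :: nat_bits n.
  case: n => // n _; rewrite /nat_bits.
  have -> : BinNat.N.of_nat n.+1.*2 = BinNat.N.double (BinNat.N.of_nat n.+1) by lia.
  by [].
have dblS n : nat_bits n.*2.+1 = true :: nat_bits n.
  rewrite /nat_bits.
  have -> : BinNat.N.of_nat n.*2.+1 = BinNat.N.succ_double (BinNat.N.of_nat n) by lia.
  by case: (BinNat.N.of_nat n).
move=> v_gt0; rewrite -[in LHS](odd_double_half v).
case: (odd v) (odd_double_half v) => /= E; first by rewrite dblS.
by rewrite add0n dbl //; lia.
Qed.

(** Unique decoding is stated with arbitrary remainders, the form that passes through concatenation;
    the later [_prefix] lemmas follow the same pattern. *)
Lemma enc_nat_prefix m n r1 r2 :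
  enc_nat m ++ r1 = enc_nat n ++ r2 -> m = n /\ r1 = r2.
Proof.
rewrite /enc_nat => E.
suff [/nat_bits_inj -> ->] : nat_bits m = nat_bits n /\ r1 = r2 by [].
elim: (nat_bits m) (nat_bits n) E => [|b s IH] [|b' s'] //=; first by case.
by case=> -> /IH [-> ->].
Qed.

Lemma flatten_enc_nat_inj : injective (fun s => flatten (map enc_nat s)).
Proof.
have nz n (r : seq bool) : enc_nat n ++ r <> [::].
  by rewrite /enc_nat -catA; case: (flatten _).
elim=> [|m s1 IH] [|n s2] //=; first by move/esym/nz.
- by move/nz.
- by case/enc_nat_prefix=> -> /IH ->.
Qed.

Lemma eq_cat_size (T : Type) (s1 s2 r1 r2 : seq T) :
  size s1 = size s2 -> s1 ++ r1 = s2 ++ r2 -> s1 = s2 /\ r1 = r2.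
Proof.
elim: s1 s2 => [|a s1 IH] [|b s2] //= [/IH {}IH] [-> /IH].
by case=> -> ->.
Qed.

Lemma ser_term_prefix t1 t2 r1 r2 :
  ser_term t1 ++ r1 = ser_term t2 ++ r2 -> t1 = t2 /\ r1 = r2.
Proof.
case: t1 t2 => [v|s] [v'|s'] //=; first by case=> -> ->.
by case=> sz /(eq_cat_size sz) [-> ->].
Qed.

Lemma ser_atom_prefix a1 a2 r1 r2 :
  ser_atom a1 ++ r1 = ser_atom a2 ++ r2 -> a1 = a2 /\ r1 = r2.
Proof.
case: a1 a2 => [t u|t i u] [t' u'|t' i' u'] //=; rewrite -?catA.
  by case=> /ser_term_prefix [-> /ser_term_prefix [-> ->]].
by case=> /ser_term_prefix [-> /=] [-> /ser_term_prefix [-> ->]].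
Qed.

Lemma ser_bexp_prefix e1 e2 r1 r2 :
  ser_bexp e1 ++ r1 = ser_bexp e2 ++ r2 -> e1 = e2 /\ r1 = r2.
Proof.
elim: e1 e2 => [||e IH|a] [||e'|a'] //=; try by case.
  by case=> /IH [-> ->].
by case=> /ser_atom_prefix [-> ->].
Qed.

Lemma ser_bexps_inj : injective (fun f => flatten (map ser_bexp f)).
Proof.
have nz e (r : seq nat) : ser_bexp e ++ r <> [::] by case: e.
elim=> [|e1 f1 IH] [|e2 f2] //=; first by move/esym/nz.
- by move/nz.
- by case/ser_bexp_prefix=> -> /IH ->.
Qed.

(** [EQCAT_CONST_SAT] asks for some instance with the given code; injectivity identifies it with the
    one that was encoded. *)
Lemma encode_instance_inj : injective encode_instance.
Proof.
move=> [sg f b] [sg' f' b'] /flatten_enc_nat_inj; rewrite /ser_instance /=.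
by case=> -> szb /(eq_cat_size szb) [-> [_ /ser_bexps_inj ->]].
Qed.

(** * Stack programs and their simulation by a Turing machine *)

(* [Rin]: input, last bit on top; [Rx]: the input with its first bit on top;
   [Rs], [Ra]: base and accumulator of powers; [Rm], [Rb1], [Rb2], [Rb3], [Rj]:
   unary loop bounds; [Rp], [Rd]: the variables of the first and of the last cell
   of the next window; [Rw]: the period; [Rc]: number of conjuncts emitted;
   [Rbody]: output, last bit on top; [Rt1], [Rt2], [Rf]: scratch. *)
Inductive reg :=
  | Rin | Rx | Rs | Ra | Rt1 | Rt2 | Rf | Rm | Rb1 | Rb2 | Rb3
  | Rp | Rd | Rw | Rj | Rc | Rbody.

Definition reg_enum : seq reg :=
  [:: Rin; Rx; Rs; Ra; Rt1; Rt2; Rf; Rm; Rb1; Rb2; Rb3;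
      Rp; Rd; Rw; Rj; Rc; Rbody].

Definition reg_rank (r : reg) : nat :=
  match r with
  | Rin => 0 | Rx => 1 | Rs => 2 | Ra => 3 | Rt1 => 4 | Rt2 => 5 | Rf => 6
  | Rm => 7 | Rb1 => 8 | Rb2 => 9 | Rb3 => 10 | Rp => 11 | Rd => 12
  | Rw => 13 | Rj => 14 | Rc => 15 | Rbody => 16
  end.

Lemma reg_rankK : cancel reg_rank (nth Rin reg_enum).
Proof. by case. Qed.

HB.instance Definition _ := Countable.copy reg (can_type reg_rankK).

Lemma reg_enumP : Finite.axiom reg_enum.
Proof. by case. Qed.

HB.instance Definition _ := isFinite.Build reg reg_enumP.

Record store := Store {
  sin : seq bool; sx : seq bool; ss : seq bool; sa : seq bool;
  st1 : seq bool; st2 : seq bool; sf : seq bool; sm : seq bool;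
  sb1 : seq bool; sb2 : seq bool; sb3 : seq bool; sp : seq bool;
  sd : seq bool; sw : seq bool; sj : seq bool; sc : seq bool;
  sbody : seq bool
}.

Definition get (r : reg) (s : store) : seq bool :=
  match r with
  | Rin => sin s | Rx => sx s | Rs => ss s | Ra => sa s | Rt1 => st1 s
  | Rt2 => st2 s | Rf => sf s | Rm => sm s | Rb1 => sb1 s | Rb2 => sb2 s
  | Rb3 => sb3 s | Rp => sp s | Rd => sd s | Rw => sw s | Rj => sj s
  | Rc => sc s | Rbody => sbody s
  end.

(** Comparing ranks by [eqn] lets [put] reduce on concrete registers, so that most equalities of
    stores hold by computation. *)
Definition put (r : reg) (v : seq bool) (s : store) : store :=
  let u r' x := if eqn (reg_rank r') (reg_rank r) then v else x in
  Store (u Rin (sin s)) (u Rx (sx s)) (u Rs (ss s)) (u Ra (sa s))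
    (u Rt1 (st1 s)) (u Rt2 (st2 s)) (u Rf (sf s)) (u Rm (sm s))
    (u Rb1 (sb1 s)) (u Rb2 (sb2 s)) (u Rb3 (sb3 s)) (u Rp (sp s))
    (u Rd (sd s)) (u Rw (sw s)) (u Rj (sj s)) (u Rc (sc s))
    (u Rbody (sbody s)).

Lemma get_put r' r v s : get r' (put r v s) = if r' == r then v else get r' s.
Proof. by case: r'; case: r. Qed.

(* [Case] and [Loop] pop the top of their register; [Case r cn c0 c1] runs [cn]
   on an empty register, and [Loop r c0 c1] exits on it. *)
Inductive cmd :=
  | Skip
  | Push of reg & bool
  | Seq of cmd & cmd
  | Case of reg & cmd & cmd & cmd
  | Loop of reg & cmd & cmd.

Definition cmd_eq_dec (c1 c2 : cmd) : {c1 = c2} + {c1 <> c2}.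
Proof.
have reg_dec (x y : reg) : {x = y} + {x <> y} by apply: eq_comparable.
have bool_dec (x y : bool) : {x = y} + {x <> y} by apply: eq_comparable.
decide equality.
Defined.

HB.instance Definition _ := hasDecEq.Build cmd (compareP cmd_eq_dec).

Inductive stackop := ONone | OPush of reg & bool | OPop of reg.

(* The control of a running program is the list of commands still to be run. *)
Definition cop (k : seq cmd) : stackop :=
  match k with
  | Push r b :: _ => OPush r b
  | Case r _ _ _ :: _ | Loop r _ _ :: _ => OPop r
  | _ => ONone
  end.

Definition cnext (k : seq cmd) (v : option bool) : seq cmd :=
  match k with
  | [::] => [::]
  | Skip :: k' | Push _ _ :: k' => k'
  | Seq c1 c2 :: k' => [:: c1, c2 & k']
  | Case _ cn c0 c1 :: k' =>
      (if v is Some b then if b then c1 else c0 else cn) :: k'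
  | Loop r c0 c1 :: k' =>
      if v is Some b then [:: if b then c1 else c0, Loop r c0 c1 & k'] else k'
  end.

Definition cstep (x : seq cmd * store) : seq cmd * store :=
  let: (k, s) := x in
  match cop k with
  | ONone => (cnext k None, s)
  | OPush r b => (cnext k None, put r (b :: get r s) s)
  | OPop r => match get r s with
              | [::] => (cnext k None, s)
              | b :: l => (cnext k (Some b), put r l s)
              end
  end.

(** The control lists that occur while [c] runs on top of [k], before the exit to [k]. A loop body
    returns to the loop itself, so the list is finite and read off the syntax; it supplies the
    states of the machine. *)
Fixpoint reach (c : cmd) (k : seq cmd) : seq (seq cmd) :=
  (c :: k) :: match c with
  | Skip | Push _ _ => [::]
  | Seq c1 c2 => reach c1 (c2 :: k) ++ reach c2 k
  | Case _ cn c0 c1 => reach cn k ++ reach c0 k ++ reach c1 k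
  | Loop _ c0 c1 => reach c0 (c :: k) ++ reach c1 (c :: k)
  end.

Lemma reach_start c k : c :: k \in reach c k.
Proof. by case: c => *; rewrite inE eqxx. Qed.

Lemma reach_closed c k k' v :
  k' \in reach c k -> cnext k' v \in k :: reach c k.
Proof.
elim: c k k' => [|r b|c1 IH1 c2 IH2|r cn IHn c0 IH0 c1 IH1|r c0 IH0 c1 IH1] k k'
  /=; rewrite in_cons => /orP[/eqP->|] //=; rewrite ?inE ?eqxx //.
- by rewrite mem_cat reach_start !orbT.
- rewrite mem_cat => /orP[/IH1|/IH2]; rewrite inE !mem_cat.
    by case/orP=> [/eqP->|->]; rewrite ?reach_start !orbT.
  by case/orP=> [->|->]; rewrite ?orbT.
- by case: (v) => [[]|]; rewrite !mem_cat reach_start ?orbT.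
- rewrite !mem_cat => /or3P[/IHn|/IH0|/IH1]; rewrite inE;
    by case/orP=> ->; rewrite ?orbT.
- by case: (v) => [[]|]; rewrite ?eqxx ?mem_cat ?reach_start ?orbT.
- rewrite mem_cat => /orP[/IH0|/IH1]; rewrite inE mem_cat;
    by case/orP=> [|->]; rewrite ?orbT // => /eqP->; rewrite eqxx ?orbT.
Qed.

Definition conts (c : cmd) := [::] :: reach c [::].

Lemma conts_cnext c k v : k \in conts c -> cnext k v \in conts c.
Proof.
by rewrite inE => /orP[/eqP-> //|]; rewrite /conts; apply: reach_closed.
Qed.

Lemma conts_start c : [:: c] \in conts c.
Proof. by rewrite inE reach_start orbT. Qed.

(* All registers share one tape, one track each: the bottom of every register
   lies in the cell whose first component is [true]. *)
Definition tsym := (bool * {ffun reg -> option bool})%type.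
Definition tblank : tsym := (false, [ffun=> None]).

Definition track_upd (a : tsym) (r : reg) (v : option bool) : tsym :=
  (a.1, [ffun r' => if r' == r then v else a.2 r']).

(** Registers are listed from the top, tracks are laid out from the bottom, hence [rev]. *)
Definition cellof (s : store) (j : nat) : tsym :=
  (j == 0, [ffun r => onth (rev (get r s)) j]).

Definition ctl (c : cmd) (i : 'I_(size (reach c [::])).+1) : seq cmd :=
  nth [::] (conts c) i.
Definition unctl (c : cmd) (k : seq cmd) : 'I_(size (reach c [::])).+1 :=
  inord (index k (conts c)).

Lemma unctlK c k : k \in conts c -> ctl (unctl c k) = k.
Proof.
move=> kc; rewrite /ctl /unctl inordK ?nth_index //.
by rewrite -index_mem in kc.
Qed.

(* [None]: initial state; [inl last]: looking for the top of the current
   register, having just read [last]; [inr (Some b)]: about to erase the top,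
   which is [b]; [inr None]: going back to the marked cell. *)
Definition tstate (c : cmd) : finType :=
  option ('I_(size (reach c [::])).+1 * (option bool + option bool)).

(** The top of a track is recognised one cell too late, at the first empty cell. A pop therefore
    remembers the last bit read and steps back; if no bit was read, the register is empty and the
    head is still on the marked cell. *)
Definition tdelta (c : cmd) (q : tstate c) (a : tsym) :
    tstate c * tsym * move :=
  let goto k (ph : option bool + option bool) : tstate c :=
    Some (unctl c k, ph) in
  match q with
  | None => (goto [:: c] (inl None), (true, a.2), MStay)
  | Some (i, inl last) =>
    match cop (ctl i) with
    | ONone => (goto (cnext (ctl i) None) (inl None), a, MStay)
    | OPush r b =>
      if a.2 r is Some _ then (q, a, MRight)
      else (goto (cnext (ctl i) None) (inr None), track_upd a r (Some b), MStay)
    | OPop r =>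
      if a.2 r is Some b then (Some (i, inl (Some b)), a, MRight)
      else if last is Some b then (Some (i, inr (Some b)), a, MLeft)
      else (goto (cnext (ctl i) None) (inl None), a, MStay)
    end
  | Some (i, inr (Some b)) =>
    if cop (ctl i) is OPop r
    then (goto (cnext (ctl i) (Some b)) (inr None), track_upd a r None, MStay)
    else (q, a, MStay)
  | Some (i, inr None) =>
    if a.1 then (Some (i, inl None), a, MStay) else (q, a, MLeft)
  end.

Definition thalt (c : cmd) (q : tstate c) : bool :=
  if q is Some (i, inl _) then ctl i == [::] else false.

Definition cmdTM (c : cmd) : TM := {|
  tm_state := tstate c;
  tm_sym := tsym;
  tm_blank := tblank;
  tm_in := fun b => (false, [ffun r => if r == Rin then Some b else None]);
  tm_out := fun a => a.2 Rbody;
  tm_start := None;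
  tm_halt := @thalt c;
  tm_accept := pred0;
  tm_delta := @tdelta c
|}.

(** Positions are absolute, and the default [tblank] identifies tapes that differ in trailing
    blanks. A left move on an empty left part would shift all positions, so [rep_left] starts from
    [i.+1]. *)
Definition rep (f : nat -> tsym) (i : nat) (tp : seq tsym * tsym * seq tsym) :=
  size tp.1.1 = i /\
  forall j, nth tblank (rev tp.1.1 ++ tp.1.2 :: tp.2) j = f j.

Lemma rep_head f i l a r : rep f i (l, a, r) -> a = f i.
Proof. by case=> /= <- <-; rewrite nth_cat size_rev ltnn subnn. Qed.

Lemma rep_ext f g i tp : f =1 g -> rep f i tp -> rep g i tp.
Proof. by move=> fg [sz E]; split=> // j; rewrite E fg. Qed.

Lemma rep_write f i l a r b :
  rep f i (l, a, r) -> rep (fun j => if j == i then b else f j) i (l, b, r).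
Proof.
case=> /= sz E; split=> //= j; rewrite -E !nth_cat size_rev sz.
by case: ltngtP => [//|ij|->]; rewrite ?subnn //; case: (j - i) (subn_gt0 i j); rewrite ij.
Qed.

Lemma rep_right c f i tp : rep f i tp -> rep f i.+1 (move_tape (cmdTM c) MRight tp).
Proof.
case: tp => [[l a] r] [/= sz E]; case: r E => [|b r] E; split=> /=; rewrite ?sz //;
  move=> j; rewrite rev_cons cat_rcons // -E.
rewrite -(cat1s a [:: tblank]) catA nth_cat; case: ltnP => // le.
by rewrite [RHS]nth_default //; case: (j - _) => [|[]].
Qed.

Lemma rep_left c f i tp : rep f i.+1 tp -> rep f i (move_tape (cmdTM c) MLeft tp).
Proof.
case: tp => [[[|b l] a] r] [//= [sz] E]; split=> // j.
by rewrite -E rev_cons cat_rcons.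
Qed.

Definition steps (M : TM) (n : nat) (x y : config M) : Prop :=
  iter n (step M) x = y.

Lemma steps_trans M m n (x y z : config M) :
  steps m x y -> steps n y z -> steps (m + n) x z.
Proof. by move=> <- <-; rewrite /steps addnC iterD. Qed.

Lemma steps_step M n (x y z : config M) :
  step M x = y -> steps n y z -> steps n.+1 x z.
Proof. by move=> <- <-; rewrite /steps iterSr. Qed.

Definition at_ctl (c : cmd) (k : seq cmd) (ph : option bool + option bool) :
  tstate c := Some (unctl c k, ph).

Lemma steps_return c k f i tp : k \in conts c -> (forall j, (f j).1 = (j == 0)) ->
  rep f i tp ->
  exists2 tp', steps (M := cmdTM c) i.+1 (at_ctl c k (inr None), tp)
                     (at_ctl c k (inl None), tp') & rep f 0 tp'.
Proof.
move=> kc f1; elim: i tp => [|i IH] [[l a] r] R; have E := rep_head R.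
  exists (l, a, r) => //.
  by rewrite /steps /= E f1.
have [tp' S R'] := IH _ (rep_left c R).
exists tp' => //; apply: steps_step S.
by rewrite /= E f1.
Qed.

Definition last_read (k : seq cmd) (l : seq bool) (d : nat) : option bool :=
  if cop k is OPop _ then if d is d'.+1 then onth l d' else None else None.

Lemma steps_walk c k r s tp d : k \in conts c ->
  (cop k = OPop r \/ exists b, cop k = OPush r b) ->
  rep (cellof s) 0 tp -> d <= size (get r s) ->
  exists2 tp', steps (M := cmdTM c) d (at_ctl c k (inl None), tp)
                 (at_ctl c k (inl (last_read k (rev (get r s)) d)), tp') &
               rep (cellof s) d tp'.
Proof.
move=> kc opk R; elim: d => [|d IH] dl.
  by exists tp => //; rewrite /last_read; case: (cop k).
have [[[l a] rr] S R'] := IH (ltnW dl).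
exists (move_tape (cmdTM c) MRight (l, a, rr)); last exact: rep_right.
rewrite -addn1; apply: steps_trans S _.
have [b Eb] : exists b, onth (rev (get r s)) d = Some b.
  by move: (onthTE (rev (get r s)) d); rewrite size_rev dl; case: onth => // b; exists b.
have kn : k <> [::] by move=> k0; case: opk => [|[?]]; rewrite k0.
rewrite /steps /= unctlK //.
have -> : (k == [::]) = false by apply/eqP.
rewrite addn1 (rep_head R') /last_read.
by case: opk => [->|[b' ->]]; rewrite /= ffunE Eb.
Qed.

Lemma cell_push r b s j :
  (if j == size (get r s) then track_upd (cellof s j) r (Some b) else cellof s j)
  = cellof (put r (b :: get r s) s) j.
Proof.
case: ifP => [/eqP->|jn]; rewrite /cellof /track_upd /=; congr (_, _);
  apply/ffunP=> r'; rewrite !ffunE get_put; case: eqP => [r'E|] //; rewrite ?r'E;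
  rewrite rev_cons -cats1 onth_cat size_rev.
  by rewrite ltnn subnn.
case: ltnP => // le; rewrite onth_default ?size_rev //.
by rewrite [RHS]onth_default //= subn_gt0 ltn_neqAle le eq_sym jn.
Qed.

Lemma cell_pop r b l s j : get r s = b :: l ->
  (if j == size l then track_upd (cellof s j) r None else cellof s j)
  = cellof (put r l s) j.
Proof.
move=> E; case: ifP => [/eqP->|jn]; rewrite /cellof /track_upd /=; congr (_, _);
  apply/ffunP=> r'; rewrite !ffunE get_put; case: eqP => [r'E|] //; rewrite ?r'E.
  by rewrite onth_default // size_rev.
rewrite E rev_cons -cats1 onth_cat size_rev.
case: ltnP => // le; rewrite [RHS]onth_default ?size_rev //.
by rewrite onth_default //= subn_gt0 ltn_neqAle le eq_sym jn.
Qed.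

(** Walk up to the top of the register, change it, walk back to the mark: twice the height plus a
    constant. *)
Lemma steps_cstep c k s tp H : k \in conts c -> k <> [::] ->
  (forall r, size (get r s) <= H) -> rep (cellof s) 0 tp ->
  exists n tp', [/\ n <= 2 * H + 3,
    steps (M := cmdTM c) n (at_ctl c k (inl None), tp)
       (at_ctl c (cstep (k, s)).1 (inl None), tp') &
    rep (cellof (cstep (k, s)).2) 0 tp'].
Proof.
move=> kc k0 szH R.
have kF : (k == [::]) = false by apply/eqP.
rewrite /cstep; case opk: (cop k) => [|r b|r].
- exists 1, tp; split=> //; first by rewrite addnS.
  rewrite /steps /=; case: tp R => [[l a] rr] R /=.
  by rewrite unctlK // kF opk.
- have [||[[l a] rr] S R'] := @steps_walk c k r s tp (size (get r s)) kc _ R _.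
  + by right; exists b.
  + by [].
  have R2 : rep (cellof (put r (b :: get r s) s)) (size (get r s))
      (l, track_upd a r (Some b), rr).
    apply: rep_ext (rep_write _ R') => j; rewrite -cell_push (rep_head R').
    by case: eqP => // ->.
  have [|tp' S' R3] := steps_return (conts_cnext None kc) _ R2; first by [].
  exists (size (get r s) + (size (get r s)).+2), tp'; split=> //.
    by have := szH r; lia.
  apply: steps_trans S _; apply: steps_step S'.
  rewrite /= unctlK // kF opk (rep_head R') /= ffunE onth_default ?size_rev //.
- have [||[[l a] rr] S R'] := @steps_walk c k r s tp (size (get r s)) kc _ R _.
  + by left.
  + by [].
  have E1 : step (cmdTM c) (at_ctl c k (inl (last_read k (rev (get r s)) (size (get r s)))),
        (l, a, rr)) =
    if get r s is b :: _
    then (at_ctl c k (inr (Some b)), move_tape (cmdTM c) MLeft (l, a, rr))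
    else (at_ctl c (cnext k None) (inl None), (l, a, rr)).
    rewrite /= unctlK // kF opk (rep_head R') /= ffunE onth_default ?size_rev //.
    rewrite /last_read opk; case: (get r s) => [|b l'] //=.
    by rewrite rev_cons -cats1 onth_cat size_rev ltnn subnn.
  case E: (get r s) S R' E1 (szH r) => [|b l'] S R' E1 /= szr.
    exists 1, (l, a, rr); split; [lia| |exact: R'].
    exact: (steps_trans S (E1 : steps 1 _ _)).
  have := rep_left c R'; case M: (move_tape _ _ _) E1 => [[l1 a1] r1] E1 R1.
  have R2 : rep (cellof (put r l' s)) (size l') (l1, track_upd a1 r None, r1).
    apply: rep_ext (rep_write _ R1) => j; rewrite -(cell_pop _ E) (rep_head R1).
    by case: eqP => // ->.
  have [|tp' S' R3] := steps_return (conts_cnext (Some b) kc) _ R2; first by [].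
  exists ((size l').+1 + (size l').+3), tp'; split=> //; first by lia.
  apply: steps_trans S _; apply: steps_step E1 _; apply: steps_step S'.
  by rewrite /= unctlK // opk.
Qed.

Lemma cstep_conts c x : x.1 \in conts c -> (cstep x).1 \in conts c.
Proof.
case: x => k s /= kc; rewrite /cstep; case: (cop k) => [|r b|r];
  try by apply: conts_cnext.
by case: (get r s) => *; apply: conts_cnext.
Qed.

Lemma cstep_size x H : (forall r, size (get r x.2) <= H) ->
  forall r, size (get r (cstep x).2) <= H.+1.
Proof.
case: x => k s /= szH r; rewrite /cstep; case: (cop k) => [|r' b|r'] /=.
- exact: leqW.
- by rewrite get_put; case: eqP => /= [_|_]; rewrite ?ltnS; [apply: szH|apply/leqW/szH].
- case E: (get r' s) => [|b l] /=; first exact: leqW.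
  rewrite get_put; case: eqP => _; last exact: leqW.
  by have := szH r'; rewrite E /=; lia.
Qed.

(** Heights grow by at most one per step, so [H + u] bounds them throughout [u] steps. An empty
    control is a fixed point of [cstep] and costs nothing. *)
Lemma steps_iter_cstep c u x tp H : x.1 \in conts c ->
  (forall r, size (get r x.2) <= H) -> rep (cellof x.2) 0 tp ->
  exists n tp', [/\ n <= u * (2 * (H + u) + 3),
    steps (M := cmdTM c) n (at_ctl c x.1 (inl None), tp)
       (at_ctl c (iter u cstep x).1 (inl None), tp') &
    rep (cellof (iter u cstep x).2) 0 tp'].
Proof.
elim: u x tp H => [|u IH] [k s] tp H kc szH R.
  by exists 0, tp.
case: (k =P [::]) => [k0|k0].
  have fixk : iter u.+1 cstep (k, s) = (k, s).
    by elim: u.+1 => //= v ->; rewrite k0.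
  by rewrite fixk; exists 0, tp.
have [n1 [tp1 [n1H S1 R1]]] := steps_cstep kc k0 szH R.
have [n2 [tp2 [n2H S2 R2]]] :=
  IH (cstep (k, s)) tp1 H.+1 (cstep_conts kc) (cstep_size szH) R1.
exists (n1 + n2), tp2; rewrite iterSr; split=> //; last exact: steps_trans S1 S2.
by rewrite addnS -addSn mulSn; apply: leq_add => //; lia.
Qed.

Definition store0 : store :=
  Store [::] [::] [::] [::] [::] [::] [::] [::] [::] [::] [::] [::] [::] [::]
    [::] [::] [::].

Lemma get_store0 r : get r store0 = [::].
Proof. by case: r. Qed.

Lemma init_rep c x : exists2 tp,
  steps (M := cmdTM c) 1 (init_config (cmdTM c) x) (at_ctl c [:: c] (inl None), tp) &
  rep (cellof (put Rin (rev x) store0)) 0 tp.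
Proof.
set l := [seq tm_in (cmdTM c) b | b <- x].
pose a := head tblank l; pose r := behead l.
have -> : init_config (cmdTM c) x = (None, ([::], a, r)).
  by rewrite /init_config -/l /a /r; case: (l).
exists ([::], (true, a.2), r) => //.
(* Before the first step the tape differs from [cellof] only in the missing mark on cell 0. *)
have R : rep (fun j => (false, [ffun r => onth (rev (get r (put Rin (rev x) store0))) j]))
             0 ([::], a, r).
  split=> // j; have -> : nth tblank (a :: r) j = nth tblank l j.
    rewrite /a /r; case: (l) => [|? ?] //=; case: j => [|[]] //.
  have [jx|xj] := ltnP j (size x).
    rewrite (nth_map false) //=; congr (_, _); apply/ffunP=> r'.
    rewrite !ffunE get_put; case: eqP => _; rewrite ?revK ?get_store0 ?onth0n //.
    by rewrite onthE (nth_map false).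
  rewrite nth_default ?size_map //; congr (_, _); apply/ffunP=> r'.
  rewrite !ffunE get_put; case: eqP => _; rewrite ?revK ?get_store0 ?onth0n //.
  by rewrite onth_default.
apply: rep_ext (rep_write (true, a.2) R) => j; rewrite (rep_head R) /= /cellof.
by case: j.
Qed.

Lemma read_outE c s w :
  (forall j, (nth tblank s j).2 Rbody = onth w j) -> read_out (cmdTM c) s = w.
Proof.
elim: s w => [|a s IH] w E.
  by case: w E => // b w /(_ 0); rewrite /= ffunE.
have := E 0; rewrite /=; case: w E => [|b w] E /= -> //.
by rewrite (IH w) // => j; have := E j.+1.
Qed.

Lemma cmdTM_run c x u s' :
  iter u cstep ([:: c], put Rin (rev x) store0) = ([::], s') ->
  exists2 t, t <= (u * (2 * (size x + u) + 3)).+1 &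
    tm_halt (cmdTM c) (run (cmdTM c) t x).1 /\
    output (cmdTM c) (run (cmdTM c) t x) = rev (get Rbody s').
Proof.
move=> U; have [tp S R] := init_rep c x.
have [|r|n [[[l a] r] [nH S' R']]] :=
  @steps_iter_cstep c u ([:: c], put Rin (rev x) store0) tp (size x) _ _ R.
- exact: conts_start.
- by rewrite get_put; case: eqP => _ /=; rewrite ?size_rev ?get_store0.
exists n.+1; first by [].
rewrite /run; have := steps_trans S S'; rewrite /steps add1n => ->; rewrite U /=.
split; first by rewrite unctlK // inE eqxx.
apply: (@read_outE _ (a :: r)) => j.
case: R'; rewrite U /= => /size0nil l0 /(_ j); rewrite l0 /= => ->.
by rewrite ffunE.
Qed.

(** * Running times *)

Lemma put_put r v w s : put r v (put r w s) = put r v s.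
Proof. by case: r. Qed.

Lemma put_get r s : put r (get r s) s = s.
Proof. by case: s; case: r. Qed.

(** Quantifying over the continuation [k] makes the judgement compositional; [t] is an upper bound,
    so costs may be rounded up. *)
Definition runs (c : cmd) (s : store) (t : nat) (s' : store) : Prop :=
  forall k, exists2 u, u <= t & iter u cstep (c :: k, s) = (k, s').

Lemma runs_weaken c s t t' s' : t <= t' -> runs c s t s' -> runs c s t' s'.
Proof. by move=> tt' R k; have [u ut E] := R k; exists u => //; lia. Qed.

Lemma runs_skip s : runs Skip s 1 s.
Proof. by move=> k; exists 1. Qed.

Lemma runs_push r b s : runs (Push r b) s 1 (put r (b :: get r s) s).
Proof. by move=> k; exists 1. Qed.

Lemma runs_seq c1 c2 s1 s2 s3 t1 t2 t :
  runs c1 s1 t1 s2 -> runs c2 s2 t2 s3 -> t1 + t2 < t ->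
  runs (Seq c1 c2) s1 t s3.
Proof.
move=> R1 R2 lt k; have [u1 l1 E1] := R1 (c2 :: k); have [u2 l2 E2] := R2 k.
exists (u2 + u1).+1; first by lia.
rewrite iterSr iterD; have -> : cstep (Seq c1 c2 :: k, s1) = ([:: c1, c2 & k], s1) by [].
by rewrite E1 E2.
Qed.

Lemma runs_case r cn c0 c1 s t s' :
  runs (if get r s is b :: _ then if b then c1 else c0 else cn)
       (put r (behead (get r s)) s) t s' ->
  runs (Case r cn c0 c1) s t.+1 s'.
Proof.
move=> R k; have [u l E] := R k; exists u.+1 => //.
rewrite iterSr /= /cstep /=; case: (get r s) (put_get r s) E => [|b l'] //=.
by move=> <-; rewrite put_put.
Qed.

Lemma runs_loop_nil r c0 c1 s : get r s = [::] -> runs (Loop r c0 c1) s 1 s.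
Proof. by move=> E k; exists 1; rewrite //= /cstep /= E. Qed.

Lemma runs_loop_cons r c0 c1 s b l t1 t2 s2 s3 : get r s = b :: l ->
  runs (if b then c1 else c0) (put r l s) t1 s2 ->
  runs (Loop r c0 c1) s2 t2 s3 -> runs (Loop r c0 c1) s (t1 + t2).+1 s3.
Proof.
move=> E R1 R2 k; have [u1 l1 E1] := R1 (Loop r c0 c1 :: k).
have [u2 l2 E2] := R2 k; exists (u2 + u1).+1; first by lia.
by rewrite iterSr iterD /cstep /= E E1 E2.
Qed.

(** [G i j] is the loop invariant with [i] rounds left and [j] done. The body starts after the pop,
    hence the register is reset to [i] in [G i.+1 j]. *)
Lemma runs_for r c (G : nat -> nat -> store) C n :
  (forall i j, get r (G i j) = nseq i true) ->
  (forall i j, i + j < n -> runs c (put r (nseq i true) (G i.+1 j)) C (G i j.+1)) ->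
  runs (Loop r c c) (G n 0) (n * C.+1 + 1) (G 0 n).
Proof.
move=> getG step.
suff H i j : i + j = n -> runs (Loop r c c) (G i j) (i * C.+1 + 1) (G 0 n).
  by apply: H; rewrite addn0.
elim: i j => [|i IH] j ijn; first by rewrite -ijn; apply: runs_loop_nil.
apply: (@runs_weaken _ _ (C + (i * C.+1 + 1)).+1); first by rewrite mulSn; lia.
apply: (@runs_loop_cons _ _ _ _ true (nseq i true) _ _ (G i j.+1)); first exact: getG.
  by apply: step; rewrite -ijn addSn.
by apply: IH; rewrite addnS.
Qed.

Definition seqs (cs : seq cmd) : cmd := foldr Seq Skip cs.

Definition pushes r (bs : seq bool) : cmd := seqs (map (Push r) bs).

Lemma runs_pushes r bs s :
  runs (pushes r bs) s (2 * size bs + 1) (put r (rev bs ++ get r s) s).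
Proof.
elim: bs s => [|b bs IH] s /=; first by rewrite put_get; apply: runs_skip.
have -> : rev (b :: bs) ++ get r s = rev bs ++ get r (put r (b :: get r s) s).
  by rewrite get_put eqxx rev_cons cat_rcons.
rewrite -(put_put r _ (b :: get r s)).
apply: runs_seq (runs_push _ _ _) (IH _) _; lia.
Qed.

(** * Emitting numbers and constraints *)

(** Reading a unary register destroys it, so it is moved into two copies and restored from one of
    them. *)
Definition load q : cmd :=
  let c1 := Seq (Push Rt1 true) (Push Rt2 true) in
  let c2 := Push q true in
  Seq (Loop q c1 c1) (Loop Rt2 c2 c2).

Definition counters := [:: Rp; Rd; Rc].

Lemma runs_load q s v : q \in counters -> get q s = nseq v true ->
  get Rt1 s = [::] -> get Rt2 s = [::] ->
  runs (load q) s (6 * v + 3) (put Rt1 (nseq v true) s).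
Proof.
move=> qc Eq E1 E2.
pose G i j := put q (nseq i true) (put Rt1 (nseq j true) (put Rt2 (nseq j true) s)).
pose G' i j := put q (nseq j true) (put Rt1 (nseq v true) (put Rt2 (nseq i true) s)).
have E0 : s = G v 0.
  by case: q qc Eq @G {G'} => //= _; case: s E1 E2 => /= *; congr Store.
have E3 : put Rt1 (nseq v true) s = G' 0 v.
  by case: q qc Eq {E0 G} @G' => //= _; case: s E1 E2 => /= *; congr Store.
have E4 : G 0 v = G' v 0 by case: q qc @G @G' {Eq E0 E3}.
rewrite E3 [in X in runs _ X]E0.
apply: (@runs_seq _ _ _ (G 0 v) _ (v * 4 + 1) (v * 2 + 1)); last by lia.
  apply: (@runs_for _ _ G) => [i j|i j _]; first by rewrite get_put eqxx.
  rewrite /G; clear E0 E3 E4 G G'.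
  case: q qc Eq => // _ _;
    (apply: runs_seq; [exact: runs_push|exact: (runs_push Rt2)|by []]).
rewrite E4; apply: (@runs_for _ _ G') => [i j|i j _].
  by case: q qc @G' {Eq E0 E3 E4 G}.
rewrite /G'; clear E0 E3 E4 G G'; case: q qc Eq => // _ _; exact: runs_push.
Qed.

(* Number emission peels off binary digits, least significant first, by
   halving the unary number in [Rt1]; [Rf] holds the parity. *)
Definition halve : cmd := Case Rf (Push Rf true) Skip (Push Rt2 true).

(** The first push restores the mark popped by the surrounding loop; the [true] pushed on [Rbody] is
    the continuation bit of [enc_nat]. *)
Definition emit_digit : cmd :=
  seqs [:: Push Rt1 true; Loop Rt1 halve halve; Push Rbody true;
           Case Rf (Push Rbody false) Skip (Push Rbody true);
           Loop Rt2 (Push Rt1 true) (Push Rt1 true)].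

Definition emit_unary : cmd :=
  Seq (Loop Rt1 emit_digit emit_digit) (pushes Rbody [:: false; false]).

Lemma runs_emit_digit v s :
  get Rt1 s = nseq v true -> get Rt2 s = [::] -> get Rf s = [::] ->
  runs emit_digit s (10 * v + 30)
    (put Rt1 (nseq v.+1./2 true)
      (put Rbody [:: odd v.+1, true & get Rbody s] s)).
Proof.
move=> E1 E2 Ef.
pose G i j := put Rt1 (nseq i true) (put Rf (nseq (odd j) true)
                (put Rt2 (nseq j./2 true) s)).
pose G' i j := put Rt1 (nseq j true) (put Rf [::] (put Rt2 (nseq i true)
                (put Rbody [:: odd v.+1, true & get Rbody s] s))).
have -> : put Rt1 (nseq v.+1./2 true)
      (put Rbody [:: odd v.+1, true & get Rbody s] s) = G' 0 v.+1./2.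
  by case: s E1 E2 Ef {G} @G' => /= *; congr Store.
apply: runs_seq (runs_push _ _ _) _ _.
have -> : put Rt1 (true :: get Rt1 s) s = G v.+1 0.
  by rewrite E1; case: s E1 E2 Ef {G'} @G => /= *; congr Store.
apply: (@runs_seq _ _ _ (G 0 v.+1) _ (v.+1 * 3 + 1)).
  apply: (@runs_for _ _ G) => // i j _.
  apply: runs_case; rewrite /G /= uphalf_half; case: (odd j).
  - exact: runs_push.
  - exact: runs_push.
apply: runs_seq (runs_push _ _ _) _ _.
apply: (@runs_seq _ _ _ (G' v.+1./2 0) _ 2).
  apply: runs_case; rewrite /G /G'; case: (odd v.+1) => /=.
  - exact: (runs_push Rbody).
  - exact: (runs_push Rbody).
apply: (@runs_seq _ _ _ _ _ (v.+1./2 * 2 + 1)); [|exact: runs_skip|exact: ltnSn].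
  by apply: (@runs_for _ _ G') => // i j _; apply: (runs_push Rt1).
all: try exact: ltnSn.
have := half_leq (leqnSn v.+1); have := odd_double_half v.+1; lia.
Qed.

(** [N] keeps the cost per digit fixed along the induction on halves, and [v] itself serves as a
    crude bound on the number of digits. *)
Lemma runs_emit_digits N v s : v <= N ->
  get Rt1 s = nseq v true -> get Rt2 s = [::] -> get Rf s = [::] ->
  runs (Loop Rt1 emit_digit emit_digit) s (v * (10 * N + 31) + 1)
    (put Rt1 [::] (put Rbody
      (rev (flatten [seq [:: true; b] | b <- nat_bits v]) ++ get Rbody s) s)).
Proof.
elim/ltn_ind: v s => [[|v]] IH s vN E1 E2 Ef.
  rewrite [put Rt1 _ _](_ : _ = s); first exact: runs_loop_nil.
  by case: s E1 {E2 Ef} => /= *; congr Store.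
have hv : v.+1./2 < v.+1 by have := odd_double_half v.+1; lia.
set s1 := put Rt1 (nseq v.+1./2 true)
   (put Rbody [:: odd v.+1, true & get Rbody s] s).
apply: (@runs_weaken _ _ (10 * v + 30 + (v.+1./2 * (10 * N + 31) + 1)).+1); last first.
  apply: (@runs_loop_cons _ _ _ _ true (nseq v true) _ _ s1); first exact: E1.
    exact: (@runs_emit_digit v (put Rt1 (nseq v true) s)).
  have := IH _ hv s1 (ltnW (leq_trans hv vN)) erefl E2 Ef.
  by rewrite [nat_bits v.+1]nat_bits_rec //= !rev_cons !cat_rcons.
have := leq_mul (_ : (v.+1./2).+1 <= v.+1) (leqnn (10 * N + 31)); rewrite mulSn; lia.
Qed.

Lemma runs_emit_unary v s :
  get Rt1 s = nseq v true -> get Rt2 s = [::] -> get Rf s = [::] ->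
  runs emit_unary s (v * (10 * v + 31) + 7)
    (put Rt1 [::] (put Rbody (rev (enc_nat v) ++ get Rbody s) s)).
Proof.
move=> E1 E2 Ef; rewrite /enc_nat rev_cat -catA.
by apply: runs_seq (runs_emit_digits (leqnn v) E1 E2 Ef) (runs_pushes _ _ _) _;
  rewrite -addnA ltn_add2l.
Qed.

(** Every number in the constraints is a constant or a counter plus a constant offset. *)
Inductive tok := TC of nat | TR of reg & nat.

Definition tokval (s : store) (t : tok) : nat :=
  match t with TC n => n | TR q n => n + size (get q s) end.

Definition emit (t : tok) : cmd :=
  match t with
  | TC n => pushes Rbody (enc_nat n)
  | TR q n => seqs [:: load q; pushes Rt1 (nseq n true); emit_unary]
  end.

Definition scratch (s : store) : bool :=
  [&& get Rt1 s == [::], get Rt2 s == [::] & get Rf s == [::]].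

Definition tok_ok (H : nat) (s : store) (t : tok) : bool :=
  if t is TR q _ then
    [&& q \in counters, get q s == nseq (size (get q s)) true & size (get q s) <= H]
  else true.

Lemma pboundD c1 k1 c2 k2 n :
  pbound c1 k1 n + pbound c2 k2 n <= pbound (c1 + c2) (k1 + k2) n.
Proof.
rewrite /pbound mulnDl; apply: leq_add; apply: leq_mul => //;
  by rewrite leq_pexp2l // ?leq_addr ?leq_addl.
Qed.

Lemma pboundM c1 k1 c2 k2 n :
  pbound c1 k1 n * pbound c2 k2 n = pbound (c1 * c2) (k1 + k2) n.
Proof. by rewrite /pbound expnD mulnACA. Qed.

Lemma pbound_leq c1 k1 c2 k2 n :
  c1 <= c2 -> k1 <= k2 -> pbound c1 k1 n <= pbound c2 k2 n.
Proof. by move=> c12 k12; apply: leq_mul; rewrite ?leq_pexp2l. Qed.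

Lemma pbound_mono c k m n : m <= n -> pbound c k m <= pbound c k n.
Proof.
move=> mn; rewrite /pbound leq_mul //.
by case: k => // k; rewrite leq_exp2r // ltnS.
Qed.

Lemma pbound_succ c k n : pbound c k n < pbound (c + 1) k n.
Proof. by rewrite /pbound mulnDl mul1n -[X in X < _]addn0 ltn_add2l expn_gt0. Qed.

(** The bound of the composite is built from those of its parts, so unification finds the
    existential [C] and [e] of later lemmas while the program is traversed; [H] is a common bound on
    the registers involved. *)
Lemma runs_seq_pbound c1 c2 s1 s2 s3 C1 e1 C2 e2 H :
  runs c1 s1 (pbound C1 e1 H) s2 -> runs c2 s2 (pbound C2 e2 H) s3 ->
  runs (Seq c1 c2) s1 (pbound (C1 + C2 + 1) (e1 + e2) H) s3.
Proof.
move=> R1 R2; apply: runs_seq R1 R2 _.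
exact: leq_ltn_trans (pboundD _ _ _ _ _) (pbound_succ _ _ _).
Qed.

Lemma runs_push_pbound r b s H : runs (Push r b) s (pbound 1 0 H) (put r (b :: get r s) s).
Proof. exact: runs_push. Qed.

Lemma runs_skip_pbound s H : runs Skip s (pbound 1 0 H) s.
Proof. exact: runs_skip. Qed.

Lemma runs_for_pbound r c (G : nat -> nat -> store) C e H n :
  (forall i j, get r (G i j) = nseq i true) -> n <= H ->
  (forall i j, i + j < n ->
     runs c (put r (nseq i true) (G i.+1 j)) (pbound C e H) (G i j.+1)) ->
  runs (Loop r c c) (G n 0) (pbound (C + 2) e.+1 H) (G 0 n).
Proof.
move=> getG nH R; apply: runs_weaken (runs_for getG R).
rewrite /pbound expnS; have : 0 < H.+1 ^ e by rewrite expn_gt0.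
set X := H.+1 ^ e => X1.
have : n * (C * X).+1 <= H * (C * X + X) by apply: leq_mul => //; lia.
nia.
Qed.

Lemma runs_emit t : exists C e, forall s H, scratch s -> tok_ok H s t ->
  runs (emit t) s (pbound C e H)
    (put Rbody (rev (enc_nat (tokval s t)) ++ get Rbody s) s).
Proof.
case: t => [m|q n].
  exists (2 * size (enc_nat m) + 1), 0 => s H _ _.
  by apply: runs_weaken (runs_pushes _ _ _); rewrite /pbound expn0 muln1.
(* With u = (n + 1)(H + 1), which exceeds the emitted number, loading, offset and quadratic emission
   together cost at most 70 u^2. *)
exists (70 * n.+1 ^ 2), 2 => s H /and3P[/eqP E1 /eqP E2 /eqP Ef] /and3P[qc /eqP Eq qH].
set v := size (get q s) in Eq qH *.
pose s1 := put Rt1 (nseq (n + v) true) s.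
have -> : put Rbody (rev (enc_nat (tokval s (TR q n))) ++ get Rbody s) s =
    put Rt1 [::] (put Rbody (rev (enc_nat (n + v)) ++ get Rbody s1) s1).
  by rewrite /s1 /tokval -/v; case: (s) E1 => /= *; congr Store.
apply: runs_seq; [exact: runs_load qc Eq E1 E2| |].
  apply: (@runs_seq _ _ _ s1).
  - have -> : s1 = put Rt1 (rev (nseq n true) ++ get Rt1 (put Rt1 (nseq v true) s))
                     (put Rt1 (nseq v true) s).
      by rewrite put_put get_put eqxx rev_nseq -nseqD.
    exact: runs_pushes.
  - apply: runs_seq; [|exact: runs_skip|exact: ltnSn].
    by apply: (@runs_emit_unary (n + v)).
  - exact: ltnSn.
rewrite size_nseq /pbound -mulnA -expnMn.
set u := n.+1 * H.+1; have u1 : n + v < u by rewrite /u; nia.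
have : (n + v) * (10 * (n + v) + 31) <= u * (10 * u + 31) by apply: leq_mul; lia.
rewrite -mulnn; nia.
Qed.

Definition emits (ts : seq tok) : cmd := seqs (map emit ts).

Definition enc_nats (ns : seq nat) : seq bool := flatten (map enc_nat ns).

Lemma tokval_body x H s ts : all (tok_ok H s) ts ->
  map (tokval (put Rbody x s)) ts = map (tokval s) ts /\
  all (tok_ok H (put Rbody x s)) ts.
Proof.
elim: ts => //= t ts IH /andP[tk /IH[-> ->]].
by case: t tk => [n|q n] //=; case: q => //= ->.
Qed.

Lemma runs_emits ts : exists C e, forall s H, scratch s -> all (tok_ok H s) ts ->
  runs (emits ts) s (pbound C e H)
    (put Rbody (rev (enc_nats (map (tokval s) ts)) ++ get Rbody s) s).
Proof.
elim: ts => [|t ts [C2 [e2 IH]]].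
  exists 1, 0 => s H _ _; rewrite put_get.
  exact: runs_skip_pbound.
have [C1 [e1 R]] := runs_emit t.
exists (C1 + C2 + 1), (e1 + e2) => s H sc /=/andP[tk tsk].
set s1 := put Rbody (rev (enc_nat (tokval s t)) ++ get Rbody s) s.
have -> : put Rbody (rev (enc_nats (tokval s t :: map (tokval s) ts)) ++ get Rbody s) s =
   put Rbody (rev (enc_nats (map (tokval s1) ts)) ++ get Rbody s1) s1.
  by rewrite (tokval_body _ tsk).1 put_put get_put eqxx /enc_nats /= rev_cat -catA.
apply: runs_seq_pbound (R s H sc tk) (IH s1 H sc _).
by rewrite (tokval_body _ tsk).2.
Qed.

Definition add_bexps (fs : seq sbexp) (s : store) : store :=
  put Rbody (rev (enc_nats (flatten (map ser_bexp fs))) ++ get Rbody s)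
    (put Rc (nseq (size fs) true ++ get Rc s) s).

Lemma add_bexps_cat f1 f2 s :
  add_bexps (f1 ++ f2) s = add_bexps f2 (add_bexps f1 s).
Proof.
rewrite /add_bexps map_cat flatten_cat /enc_nats map_cat flatten_cat rev_cat.
by rewrite size_cat addnC nseqD -!catA.
Qed.

Definition emit_bexps (tss : seq (seq tok)) : cmd :=
  seqs [seq Seq (emits ts) (Push Rc true) | ts <- tss].

(** [Rc] is barred because it grows while constraints are emitted, whereas the token values are
    taken in the initial store. *)
Definition entry_ok (H : nat) (s : store) (t : tok) : bool :=
  tok_ok H s t && (if t is TR Rc _ then false else true).

Lemma entry_ok_indep x y H s ts : all (entry_ok H s) ts ->
  [/\ map (tokval (put Rbody y (put Rc x s))) ts = map (tokval s) ts,
      all (entry_ok H (put Rbody y (put Rc x s))) ts &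
      all (tok_ok H s) ts].
Proof.
elim: ts => //= t ts IH /andP[tk /IH[-> -> ->]].
by case: t tk => [n|q n] //=; case: q; rewrite /entry_ok /= ?andbF ?andbT // => ->.
Qed.

Lemma runs_emit_bexps tss : exists C e, forall s H fs,
  scratch s -> all (all (entry_ok H s)) tss ->
  map (map (tokval s)) tss = map ser_bexp fs ->
  runs (emit_bexps tss) s (pbound C e H) (add_bexps fs s).
Proof.
elim: tss => [|ts tss [C2 [e2 IH]]].
  exists 1, 0 => s H [|//] _ _ _; rewrite (_ : add_bexps _ _ = s).
    exact: runs_skip_pbound.
  by case: s.
have [C1 [e1 R]] := runs_emits ts.
exists (C1 + 1 + 1 + C2 + 1), (e1 + 0 + e2) => s H [//|f fs] sc /=/andP[tk tsk] [Ef Efs].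
have [_ _ tk'] := entry_ok_indep [::] [::] tk.
set s1 := put Rbody (rev (enc_nats (map (tokval s) ts)) ++ get Rbody s) s.
have S1 : runs (Seq (emits ts) (Push Rc true)) s (pbound (C1 + 1 + 1) (e1 + 0) H)
    (add_bexps [:: f] s).
  have -> : add_bexps [:: f] s = put Rc (true :: get Rc s1) s1.
    by rewrite /add_bexps /= cats0 -Ef.
  by apply: runs_seq_pbound (R s H sc tk') (runs_push_pbound _ _ _ _).
rewrite -(cat1s f fs) add_bexps_cat.
apply: runs_seq_pbound S1 (IH (add_bexps [:: f] s) H fs sc _ _).
  elim: tss tsk {IH Efs} => //= ts' tss IHt /andP[tk1 /IHt ->].
  by have [_ -> _] := entry_ok_indep (nseq (size [:: f]) true ++ get Rc s)
     (rev (enc_nats (flatten (map ser_bexp [:: f]))) ++ get Rbody s) tk1.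
rewrite -Efs; elim: tss tsk {IH Efs} => //= ts' tss IHt /andP[tk1 /IHt ->].
by have [-> _ _] := entry_ok_indep (nseq (size [:: f]) true ++ get Rc s)
     (rev (enc_nats (flatten (map ser_bexp [:: f]))) ++ get Rbody s) tk1.
Qed.

Definition excl (ws : seq (seq nat)) (v : nat) : seq sbexp :=
  [seq BNot (BAtom (AEq (SVar v) (SConst w))) | w <- ws].

(** The constants before [t] are the serialisation tags of [BNot], [BAtom], [AEq] and [SVar]; the
    [TC 1] after it is the tag of [SConst]. *)
Definition excl_toks (ws : seq (seq nat)) (t : tok) : seq (seq tok) :=
  [seq [:: TC 2, TC 3, TC 0, TC 0, t, TC 1, TC (size w) & map TC w] | w <- ws].

Lemma excl_toksE s ws t :
  map (map (tokval s)) (excl_toks ws t) = map ser_bexp (excl ws (tokval s t)).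
Proof.
rewrite -!map_comp; apply: eq_map => w /=.
by rewrite -map_comp (eq_map (g := id)) ?map_id.
Qed.

Lemma excl_toks_ok H s ws t :
  entry_ok H s t -> all (all (entry_ok H s)) (excl_toks ws t).
Proof.
move=> tk; rewrite all_map; elim: ws => //= w ws ->.
by rewrite tk !andbT; elim: w.
Qed.

(* The constraints on the cells with variables [i], [i + 2], [i + 4], ...; the
   odd variables are reserved for the windows. *)
Fixpoint cells (i : nat) (gs : seq (seq (seq nat))) : seq sbexp :=
  if gs is ws :: gs' then excl ws i ++ cells i.+2 gs' else [::].

Lemma cells_cat i g1 g2 :
  cells i (g1 ++ g2) = cells i g1 ++ cells (i + (size g1).*2) g2.
Proof.
elim: g1 i => [|ws g1 IH] i /=; first by rewrite addn0.
by rewrite IH catA -addSnnS -addSnnS.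
Qed.

(** Cell variables are even, so [Rd] advances by two; [Rw] counts cells and thus ends up holding the
    period. *)
Definition cell (ws : seq (seq nat)) : cmd :=
  seqs [:: emit_bexps (excl_toks ws (TR Rd 0)); Push Rd true; Push Rd true;
           Push Rw true].

Definition advance (gs : seq (seq (seq nat))) (s : store) : store :=
  put Rw (nseq (size gs) true ++ get Rw s)
    (put Rd (nseq (size gs).*2 true ++ get Rd s)
      (add_bexps (cells (size (get Rd s)) gs) s)).

Lemma advance_cat g1 g2 s : advance (g1 ++ g2) s = advance g2 (advance g1 s).
Proof.
rewrite /advance cells_cat add_bexps_cat /= !size_cat size_nseq.
by rewrite [size g1 + _]addnC doubleD !nseqD -!catA [_ + size (sd s)]addnC.
Qed.

Lemma advance0 s : advance [::] s = s.
Proof. by case: s. Qed.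

Lemma runs_cell ws : exists C e, forall s H v,
  scratch s -> get Rd s = nseq v true -> v <= H ->
  runs (cell ws) s (pbound C e H) (advance [:: ws] s).
Proof.
have [C [e R]] := runs_emit_bexps (excl_toks ws (TR Rd 0)).
eexists; eexists => s H v sc Ed vH.
have tk : entry_ok H s (TR Rd 0).
  by rewrite /entry_ok /tok_ok /= -/(get Rd s) Ed size_nseq eqxx vH.
apply: runs_seq_pbound (R s H _ sc (excl_toks_ok _ tk) (excl_toksE _ _ _)) _.
apply: runs_seq_pbound (runs_push_pbound _ _ _ _) _.
apply: runs_seq_pbound (runs_push_pbound _ _ _ _) _.
rewrite /advance /= cats0.
exact: runs_seq_pbound (runs_push_pbound _ _ _ _) (runs_skip_pbound _ _).
Qed.

(** The empty word also occurs at position 4 of a four-letter word, so [xne] has to exclude it from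
    the new cell [d]. *)
Definition window (xne xwin : seq (seq nat)) (p d : nat) : seq sbexp :=
  [seq BAtom (ACont (SVar p.+1) c.1 (SVar c.2))
     | c <- [:: (1, p); (2, p.+2); (3, p.+4); (4, d)]]
  ++ excl xne d ++ excl xwin p.+1.

Fixpoint windows xne xwin (n p d : nat) : seq sbexp :=
  if n is n'.+1 then window xne xwin p d ++ windows xne xwin n' p.+2 d.+2
  else [::].

Lemma windowsD xne xwin m n p d : windows xne xwin (m + n) p d =
  windows xne xwin m p d ++ windows xne xwin n (p + m.*2) (d + m.*2).
Proof.
elim: m p d => [|m IH] p d /=; first by rewrite !addn0.
by rewrite IH catA -!addSnnS.
Qed.

Definition slide xne xwin : cmd :=
  let cont i t := [:: TC 3; TC 1; TC 0; TR Rp 1; TC i; TC 0; t] in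
  seqs [:: emit_bexps ([:: cont 1 (TR Rp 0); cont 2 (TR Rp 2);
                           cont 3 (TR Rp 4); cont 4 (TR Rd 0)]
                       ++ excl_toks xne (TR Rd 0) ++ excl_toks xwin (TR Rp 1));
           Push Rp true; Push Rp true; Push Rd true; Push Rd true].

Definition slid xne xwin (n : nat) (s : store) : store :=
  put Rp (nseq n.*2 true ++ get Rp s)
    (put Rd (nseq n.*2 true ++ get Rd s)
      (add_bexps
        (windows xne xwin n (size (get Rp s)) (size (get Rd s))) s)).

Lemma slidD xne xwin m n s :
  slid xne xwin (m + n) s = slid xne xwin n (slid xne xwin m s).
Proof.
rewrite /slid windowsD add_bexps_cat /= !size_cat size_nseq.
rewrite [m + _]addnC doubleD !nseqD -!catA.
by rewrite [_ + size (sp s)]addnC [_ + size (sd s)]addnC.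
Qed.

Lemma slid0 xne xwin s : slid xne xwin 0 s = s.
Proof. by case: s. Qed.

Lemma runs_slide xne xwin : exists C e, forall s H u v,
  scratch s -> get Rp s = nseq u true -> get Rd s = nseq v true ->
  u <= H -> v <= H ->
  runs (slide xne xwin) s (pbound C e H) (slid xne xwin 1 s).
Proof.
rewrite /slide; set tss := _ ++ _.
have [C [e R]] := runs_emit_bexps tss.
eexists; eexists => s H u v sc Ep Ed uH vH.
have tkp n : entry_ok H s (TR Rp n).
  by rewrite /entry_ok /tok_ok /= -/(get Rp s) Ep size_nseq eqxx uH.
have tkd n : entry_ok H s (TR Rd n).
  by rewrite /entry_ok /tok_ok /= -/(get Rd s) Ed size_nseq eqxx vH.
apply: (runs_seq_pbound (R s H
  (window xne xwin (size (get Rp s)) (size (get Rd s))) sc _ _)).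
- by rewrite /tss !all_cat !excl_toks_ok //= !tkp tkd.
- by rewrite /tss /window !map_cat !excl_toksE.
do 4!apply: runs_seq_pbound (runs_push_pbound _ _ _ _) _.
rewrite /slid /= cats0; exact: runs_skip_pbound.
Qed.

(** * Products and powers in unary *)

Definition mul_cmd : cmd :=
  let c1 := seqs [:: Push Rt1 true; Push Rt2 true] in
  let c2 := seqs [:: Loop Rs c1 c1; Loop Rt1 (Push Rs true) (Push Rs true)] in
  seqs [:: Loop Ra c2 c2; Loop Rt2 (Push Ra true) (Push Ra true)].

Lemma runs_mul : exists C e, forall s H a v,
  get Rt1 s = [::] -> get Rt2 s = [::] ->
  get Rs s = nseq v true -> get Ra s = nseq a true ->
  a <= H -> v <= H -> a * v <= H ->
  runs mul_cmd s (pbound C e H) (put Ra (nseq (a * v) true) s).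
Proof.
eexists; eexists => s H a v E1 E2 Es Ea aH vH avH.
pose G i j := put Ra (nseq i true) (put Rt2 (nseq (j * v) true) s).
pose G' i j := put Ra (nseq j true) (put Rt2 (nseq i true) s).
have [E0 E3] : s = G a 0 /\ put Ra (nseq (a * v) true) s = G' 0 (a * v).
  by split; case: s E1 E2 Es Ea @G @G' => /= *; congr Store.
rewrite [in X in runs _ X]E0 E3; apply: (@runs_seq_pbound _ _ _ (G 0 a)).
  apply: (@runs_for_pbound _ _ G) => // i j _.
  pose K i' j' := put Rs (nseq i' true) (put Rt1 (nseq j' true)
     (put Rt2 (nseq (j' + j * v) true) (put Ra (nseq i true) s))).
  pose K' i' j' := put Rs (nseq j' true) (put Rt1 (nseq i' true)
     (put Rt2 (nseq (v + j * v) true) (put Ra (nseq i true) s))).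
  have [E4 E5] : put Ra (nseq i true) (G i.+1 j) = K v 0 /\ G i j.+1 = K' 0 v.
    by split; case: s E1 E2 Es Ea @G @G' @K @K' {E0 E3} => /= *; congr Store.
  rewrite E4 E5; apply: (@runs_seq_pbound _ _ _ (K 0 v)).
    apply: (@runs_for_pbound _ _ K) => // i' j' _.
    apply: runs_seq_pbound (runs_push_pbound _ _ _ _) _.
    exact: runs_seq_pbound (runs_push_pbound Rt2 _ _ _) (runs_skip_pbound _ _).
  apply: runs_seq_pbound _ (runs_skip_pbound _ _).
  by apply: (@runs_for_pbound _ _ K') => // i' j' _; apply: (runs_push_pbound Rs).
apply: runs_seq_pbound _ (runs_skip_pbound _ _).
by apply: (@runs_for_pbound _ _ G') => // i j _; apply: (runs_push_pbound Ra).
Qed.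

Definition pow_cmd (c k : nat) : cmd :=
  Seq (pushes Ra (nseq c true)) (seqs (nseq k mul_cmd)).

Lemma runs_pow c k : exists C e, forall s H v,
  get Rt1 s = [::] -> get Rt2 s = [::] -> get Ra s = [::] ->
  get Rs s = nseq v.+1 true -> c * v.+1 ^ k <= H -> v < H ->
  runs (pow_cmd c k) s (pbound C e H) (put Ra (nseq (c * v.+1 ^ k) true) s).
Proof.
have [C1 [e1 R]] := runs_mul.
have [C [e RL]] : exists C e, forall s H a v,
    get Rt1 s = [::] -> get Rt2 s = [::] ->
    get Rs s = nseq v.+1 true -> get Ra s = nseq a true ->
    a * v.+1 ^ k <= H -> v < H ->
    runs (seqs (nseq k mul_cmd)) s (pbound C e H)
      (put Ra (nseq (a * v.+1 ^ k) true) s).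
  elim: k => [|k [C2 [e2 IH]]].
    exists 1, 0 => s H a v _ _ _ Ea _ _; rewrite muln1 -Ea put_get.
    exact: runs_skip_pbound.
  eexists; eexists => s H a v E1 E2 Es Ea aH vH.
  (* The base is positive, so intermediate products never exceed the final one, which [H] bounds. *)
  have le1 : a <= a * v.+1 ^ k.+1 by rewrite leq_pmulr // expn_gt0.
  have le2 : a * v.+1 <= a * v.+1 ^ k.+1.
    by rewrite expnS mulnA leq_pmulr // expn_gt0.
  apply: (runs_seq_pbound (R s H a v.+1 E1 E2 Es Ea _ vH _)).
  - exact: leq_trans le1 aH.
  - exact: leq_trans le2 aH.
  rewrite expnS mulnA in aH *.
  exact: (IH (put Ra (nseq (a * v.+1) true) s) H (a * v.+1) v).
eexists; eexists => s H v E1 E2 Ea Es cH vH.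
apply: (@runs_seq_pbound _ _ _ (put Ra (nseq c true) s) _ (2 * c + 1) 0).
  have := runs_pushes Ra (nseq c true) s.
  by rewrite rev_nseq size_nseq Ea cats0 /pbound expn0 muln1.
exact: (RL (put Ra (nseq c true) s) H c v).
Qed.

(** * The program computing the reduction *)

Lemma put_putC r r' v w s :
  r != r' -> put r v (put r' w s) = put r' w (put r v s).
Proof. by case: r; case: r'. Qed.

(** No register grows by more than the running time; this bounds the length of the emitted text
    without measuring the serialisation. *)
Lemma runs_size c s t s' h : runs c s t s' ->
  (forall r, size (get r s) <= h) -> forall r, size (get r s') <= h + t.
Proof.
move=> R szh r; have [u ut E] := R [::].
have : size (get r (iter u cstep ([:: c], s)).2) <= h + u.
  elim: u {ut E} r => [|u IH] r /=; first by rewrite addn0; apply: szh.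
  by rewrite addnS; apply: cstep_size => r'; apply: IH.
by rewrite E /=; lia.
Qed.

Lemma runs_move r r' s : r != r' ->
  runs (Loop r (Push r' false) (Push r' true)) s (2 * size (get r s) + 1)
    (put r [::] (put r' (rev (get r s) ++ get r' s) s)).
Proof.
move=> rr'; move El: (get r s) => l; elim: l s El => [|b l IH] s El.
  by rewrite put_get -{2}El put_get; apply: runs_loop_nil.
set s1 := put r' (b :: get r' s) (put r l s).
have E1 : get r s1 = l by rewrite /s1 !get_put eqxx (negPf rr').
have -> : put r [::] (put r' (rev (b :: l) ++ get r' s) s) =
          put r [::] (put r' (rev l ++ get r' s1) s1).
  rewrite /s1 get_put eqxx rev_cons cat_rcons !put_put.
  by rewrite ![put r _ (put r' _ _)]put_putC // put_put.
apply: (@runs_weaken _ _ (1 + (2 * size l + 1)).+1); first by rewrite /=; lia.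
apply: runs_loop_cons El _ (IH _ E1).
have -> : s1 = put r' (b :: get r' (put r l s)) (put r l s).
  by rewrite get_put eq_sym (negPf rr').
by case: b {s1 E1}; apply: runs_push.
Qed.

Definition poly (f : nat -> nat) : Prop :=
  exists C e, forall n, f n <= pbound C e n.

Lemma polyC c : poly (fun=> c).
Proof. by exists c, 0 => n; rewrite /pbound muln1. Qed.

Lemma poly_id : poly id.
Proof. by exists 1, 1 => n; rewrite /pbound mul1n expn1. Qed.

Lemma polyD f g : poly f -> poly g -> poly (fun n => f n + g n).
Proof.
move=> [C1 [e1 F]] [C2 [e2 G]]; do 2!eexists; move=> n.
exact: leq_trans (leq_add (F n) (G n)) (pboundD _ _ _ _ _).
Qed.

Lemma polyM f g : poly f -> poly g -> poly (fun n => f n * g n).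
Proof.
move=> [C1 [e1 F]] [C2 [e2 G]]; do 2!eexists; move=> n.
by apply: leq_trans (leq_mul (F n) (G n)) _; rewrite pboundM.
Qed.

Lemma poly_pbound C e f : poly f -> poly (fun n => pbound C e (f n)).
Proof.
move=> pf; apply: polyM; first exact: polyC.
elim: e => [|e IH]; first exact: polyC.
have [C1 [e1 E]] := polyM (polyD (polyC 1) pf) IH.
by exists C1, e1 => n; rewrite expnS -add1n.
Qed.

Lemma runs_cells r ws : r \in [:: Rb1; Rb2; Rm] ->
  exists C e, forall s H v n, scratch s -> get Rd s = nseq v true ->
  get r s = nseq n true -> v + n.*2 <= H ->
  runs (Loop r (cell ws) (cell ws)) s (pbound C e H)
    (put r [::] (advance (nseq n ws) s)).
Proof.
move=> rin; have [C [e R]] := runs_cell ws.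
eexists; eexists => s H v n sc Ed Er vH.
pose G i j := put r (nseq i true) (advance (nseq j ws) s).
have -> : put r [::] (advance (nseq n ws) s) = G 0 n by [].
have E0 : s = G n 0 by rewrite /G advance0 -Er put_get.
rewrite [in X in runs _ X]E0; apply: (@runs_for_pbound _ _ G).
- by move=> i j; rewrite get_put eqxx.
- lia.
move=> i j ijn; rewrite /G put_put.
have -> : put r (nseq i true) (advance (nseq j.+1 ws) s) =
          advance [:: ws] (put r (nseq i true) (advance (nseq j ws) s)).
  rewrite -addn1 nseqD advance_cat.
  by move: rin; rewrite !inE => /or3P[]/eqP->.
apply: (R _ _ (j.*2 + v)); last by lia.
- by move: rin; rewrite !inE => /or3P[]/eqP->; exact: sc.
- rewrite nseqD -Ed; move: rin; rewrite !inE.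
  by case/or3P=> /eqP->; rewrite /advance /= size_nseq.
Qed.

(** The body depends on the popped bit, so [runs_for] does not apply and the induction is on the
    word. Each bit yields two cells, as in [pair_bits]. *)
Lemma runs_bits (X : bool -> seq (seq nat)) :
  exists C e, forall s H v x, scratch s -> get Rd s = nseq v true ->
  get Rx s = x -> v + 4 * size x <= H ->
  let dbl b := Seq (cell (X b)) (cell (X b)) in
  runs (Loop Rx (dbl false) (dbl true)) s (pbound C e H)
    (put Rx [::] (advance (flatten [seq [:: X b; X b] | b <- x]) s)).
Proof.
have [C0 [e0 R0]] := runs_cell (X false).
have [C1 [e1 R1]] := runs_cell (X true).
have [C [e R]] : exists C e, forall b s H v, scratch s ->
    get Rd s = nseq v true -> v + 2 <= H ->
    runs (Seq (cell (X b)) (cell (X b))) s (pbound C e H)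
      (advance [:: X b; X b] s).
  have pb b : exists C e, forall s H v, scratch s ->
    get Rd s = nseq v true -> v + 2 <= H ->
    runs (Seq (cell (X b)) (cell (X b))) s (pbound C e H)
      (advance [:: X b; X b] s).
    have [C' [e' R']] := runs_cell (X b).
    eexists; eexists => s H v sc Ed vH.
    rewrite -cat1s advance_cat; apply: runs_seq_pbound.
      by apply: (R' s H v) => //; lia.
    apply: (R' (advance [:: X b] s) H (2 + v)) => //; last by lia.
    by rewrite nseqD -Ed.
  have [[C2 [e2 R2]] [C3 [e3 R3]]] := (pb false, pb true).
  exists (C2 + C3), (e2 + e3) => b s H v sc Ed vH.
  case: b; [apply: runs_weaken (R3 s H v sc Ed vH)|apply: runs_weaken (R2 s H v sc Ed vH)];
    by apply: pbound_leq; rewrite ?leq_addr ?leq_addl.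
exists (C + 2), e.+1 => s H v x sc Ed Ex vH dbl.
apply: (@runs_weaken _ _ (size x * (pbound C e H).+1 + 1)).
  rewrite /pbound expnS; have : 0 < H.+1 ^ e by rewrite expn_gt0.
  set Y := H.+1 ^ e => Y1.
  have : size x * (C * Y).+1 <= H * (C * Y + Y) by apply: leq_mul; lia.
  nia.
elim: x s v sc Ed Ex vH => [|b x IH] s v sc Ed Ex vH.
  by rewrite advance0 -{2}Ex put_get; apply: runs_loop_nil.
rewrite /= in vH; rewrite [size _]/= mulSn.
apply: (@runs_weaken _ _ (pbound C e H + (size x * (pbound C e H).+1 + 1)).+1).
  by lia.
pose s1 := advance [:: X b; X b] (put Rx x s).
have -> : put Rx [::] (advance (flatten [seq [:: X b0; X b0] | b0 <- b :: x]) s) =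
   put Rx [::] (advance (flatten [seq [:: X b0; X b0] | b0 <- x]) s1).
  by rewrite [flatten _]/= -[[:: X b, X b & _]]/([:: X b; X b] ++ _) advance_cat.
apply: (runs_loop_cons Ex) (IH s1 (4 + v) _ _ _ _).
- have -> : (if b then dbl true else dbl false) = dbl b by case: (b).
  by apply: (R _ (put Rx x s) H v) => //; lia.
- exact: sc.
- by rewrite nseqD -Ed.
- by [].
- by lia.
Qed.

Lemma runs_slides xne xwin :
  exists C e, forall s H u v n, scratch s ->
  get Rp s = nseq u true -> get Rd s = nseq v true ->
  get Rj s = nseq n true -> u + n.*2 <= H -> v + n.*2 <= H ->
  runs (Loop Rj (slide xne xwin) (slide xne xwin)) s (pbound C e H)
    (put Rj [::] (slid xne xwin n s)).
Proof.
have [C [e R]] := runs_slide xne xwin.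
eexists; eexists => s H u v n sc Ep Ed Ej uH vH.
pose G i j := put Rj (nseq i true) (slid xne xwin j s).
have -> : put Rj [::] (slid xne xwin n s) = G 0 n by [].
have E0 : s = G n 0 by rewrite /G slid0 -Ej put_get.
rewrite [in X in runs _ X]E0; apply: (@runs_for_pbound _ _ G) => //.
  lia.
move=> i j ijn.
have -> : G i j.+1 = slid xne xwin 1 (put Rj (nseq i true) (G i.+1 j)).
  by rewrite /G -addn1 slidD.
apply: (R _ _ (j.*2 + u) (j.*2 + v)); try lia.
- exact: sc.
- by rewrite nseqD -Ep.
- by rewrite nseqD -Ed.
Qed.

(** * Layout of the instance and the phases of its generator *)

Section Generator.

Variables (sigma : nat) (xbit : bool -> seq (seq nat)).
Variables (xblank xguess xend xne xwin : seq (seq nat)).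
Variables (c1 k1 c2 k2 : nat).

Definition witlen (n : nat) : nat := pbound c1 k1 n.
(** The time bound of the verifier on the longest [pair_bits x w], whose length is 2n + 2 plus that
    of [w]; the extra 3 keeps the head off the first three columns. *)
Definition margin (n : nat) : nat := pbound c2 k2 (n.*2 + 2 + witlen n) + 3.

(** The last [xblank] is letter W, the start of the second row, which is the target of no window. *)
Definition row0 (x : seq bool) : seq (seq (seq nat)) :=
  nseq (margin (size x)) xblank
  ++ flatten [seq [:: xbit b; xbit b] | b <- x] ++ [:: xbit false; xbit true]
  ++ nseq (witlen (size x)) xguess ++ nseq (margin (size x)) xend ++ [:: xblank].

Definition period (n : nat) : nat := n.*2 + 3 + witlen n + (margin n).*2.

Lemma size_row0 x : size (row0 x) = period (size x).
Proof.
have -> : size (row0 x) = (margin (size x)).*2 + witlen (size x) + 3 +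
    size (flatten [seq [:: xbit b; xbit b] | b <- x]).
  by rewrite /row0 !size_cat /= !size_nseq; lia.
have -> : size (flatten [seq [:: xbit b; xbit b] | b <- x]) = (size x).*2.
  by elim: x => //= b x ->; lia.
by rewrite /period; lia.
Qed.

(** The configuration after T steps occupies row T + 1, and a halting time satisfies T + 3 <=
    [margin n], so [margin n] rounds of windows reach it. *)
Definition nwindows (n : nat) : nat := margin n * period n.
Definition nvars (n : nat) : nat := (period n + nwindows n).*2.

Definition reduction (x : seq bool) : instance :=
  Instance sigma
    (cells 0 (row0 x)
     ++ windows xne xwin (nwindows (size x)) 0 (period (size x)).*2)
    (nseq (nvars (size x)) 4).

Definition read_cmd : cmd :=
  let c b := seqs [:: Push Rx b; Push Rs true; Push Rj true; Push Rj true] in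
  Loop Rin (c false) (c true).

(** [pow_cmd] expects the successor of its argument in [Rs]: first n + 1, then 2n + 3 plus the
    witness length. The margin is stored three times: for the blanks, for the end markers, and for
    the number of rounds of windows. *)
Definition setup_cmd : cmd :=
  let add_rs := Seq (Push Rm true) (Push Rs true) in
  let add_b := seqs [:: Push Rb1 true; Push Rb2 true; Push Rb3 true] in
  seqs [:: read_cmd; Push Rs true; pow_cmd c1 k1; Loop Rs Skip Skip;
           Loop Ra add_rs add_rs;
           Loop Rj (Push Rs true) (Push Rs true);
           Push Rs true; Push Rs true; Push Rs true;
           pow_cmd c2 k2; Loop Rs Skip Skip;
           Push Ra true; Push Ra true; Push Ra true;
           Loop Ra add_b add_b].

Lemma runs_read x : runs read_cmd (put Rin (rev x) store0) (pbound 10 1 (size x))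
  (put Rx x (put Rs (nseq (size x) true)
    (put Rj (nseq (size x).*2 true) store0))).
Proof.
pose st l a k := put Rin l (put Rx a (put Rs (nseq k true)
  (put Rj (nseq k.*2 true) store0))).
have H l a k : runs read_cmd (st l a k) (10 * size l + 1)
    (st [::] (catrev l a) (size l + k)).
  elim: l a k => [|b l IH] a k; first exact: runs_loop_nil.
  rewrite [size (b :: l) + k]addSnnS; apply: (@runs_weaken _ _ (9 + (10 * size l + 1)).+1).
    by rewrite [size (b :: l)]/=; lia.
  apply: (@runs_loop_cons _ _ _ _ b l _ _ (st l (b :: a) k.+1)) (IH _ _) => //.
  have R b' : runs (seqs [:: Push Rx b'; Push Rs true; Push Rj true; Push Rj true])
      (st l a k) 9 (st l (b' :: a) k.+1).
    do 4!(apply: runs_seq; [exact: runs_push| |exact: ltnSn]).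
    exact: runs_skip.
  by case: b; apply: R.
have := H (rev x) [::] 0; rewrite /pbound expn1 mulnS size_rev catrevE revK cats0 addn0.
by apply: runs_weaken; lia.
Qed.

Definition setup_store (x : seq bool) : store :=
  let B := nseq (margin (size x)) true in
  put Rx x (put Rm (nseq (witlen (size x)) true)
    (put Rb1 B (put Rb2 B (put Rb3 B store0)))).

Lemma runs_clear r s n H : get r s = nseq n true -> n <= H ->
  runs (Loop r Skip Skip) s (pbound (1 + 2) 1 H) (put r [::] s).
Proof.
move=> E nH; pose G i (j : nat) := put r (nseq i true) s.
have E0 : s = G n 0 by rewrite /G -E put_get.
rewrite [in X in runs _ X]E0; apply: (@runs_for_pbound _ _ G 1 0) => //.
  by move=> i j; rewrite get_put eqxx.
by move=> i j _; rewrite /G put_put; exact: runs_skip_pbound.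
Qed.

Lemma runs_setup : exists C e, forall x H, nvars (size x) <= H ->
  runs setup_cmd (put Rin (rev x) store0) (pbound C e H) (setup_store x).
Proof.
have [C1 [e1 R1]] := runs_pow c1 k1; have [C2 [e2 R2]] := runs_pow c2 k2.
eexists; eexists => x H; set n := size x => nH.
have mG : 2 < margin n by rewrite /margin; lia.
have bH : period n <= H.
  by apply: leq_trans nH; rewrite /nvars -addnn; lia.
have mH : witlen n <= H by move: bH; rewrite /period; lia.
pose m := witlen n; pose T := pbound c2 k2 (n.*2 + 2 + m).
have TH : T + 3 + n.*2 + 3 + m <= H.
  by move: bH; rewrite /period /margin -/m -/T; lia.
rewrite /setup_store -/n -/m /margin -/m -/T.
pose sx := put Rx x (put Rj (nseq n.*2 true) store0).
apply: (runs_seq_pbound (s2 := put Rs (nseq n true) sx)).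
  by apply: runs_weaken (runs_read x); apply: pbound_mono; rewrite -/n; lia.
apply: runs_seq_pbound (runs_push_pbound _ _ _ _) _.
apply: (runs_seq_pbound (R1 (put Rs (nseq n.+1 true) sx) H n _ _ _ _ _ _)) => //; try lia.
apply: (runs_seq_pbound (runs_clear (n := n.+1) (H := H) _ _)) => //; try lia.
pose G i j := put Ra (nseq i true) (put Rm (nseq j true) (put Rs (nseq j true) sx)).
apply: (@runs_seq_pbound _ _ (G m 0) (G 0 m)).
  apply: runs_for_pbound => // i j _.
  exact: runs_seq_pbound (runs_push_pbound _ _ _ _) (runs_push_pbound Rs _ _ _).
pose sm := put Rx x (put Rm (nseq m true) store0).
pose G2 i j := put Rj (nseq i true) (put Rs (nseq (j + m) true) sm).
apply: (@runs_seq_pbound _ _ (G2 n.*2 0) (G2 0 n.*2)).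
  apply: runs_for_pbound => // [|i j _]; first by lia.
  exact: (runs_push_pbound Rs).
do 3!apply: runs_seq_pbound (runs_push_pbound _ _ _ _) _.
apply: (@runs_seq_pbound _ _ (put Rs (nseq (n.*2 + m).+3 true) sm)
   (put Ra (nseq T true) (put Rs (nseq (n.*2 + m).+3 true) sm))).
  have TE : T = c2 * (n.*2 + m).+3 ^ k2 by rewrite /T /pbound addnAC addn2.
  by rewrite TE; apply: R2 => //; rewrite -?TE; lia.
apply: (runs_seq_pbound (runs_clear (n := (n.*2 + m).+3) (H := H) _ _)) => //; try lia.
do 3!apply: runs_seq_pbound (runs_push_pbound _ _ _ _) _.
pose G3 i j := put Ra (nseq i true) (put Rb1 (nseq j true) (put Rb2 (nseq j true)
  (put Rb3 (nseq j true) sm))).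
rewrite addn3.
apply: (@runs_seq_pbound _ _ (G3 T.+3 0) (G3 0 T.+3)); last exact: runs_skip_pbound.
apply: runs_for_pbound => // [|i j _]; first by lia.
do 2!apply: runs_seq_pbound (runs_push_pbound _ _ _ _) _.
exact: runs_seq_pbound (runs_push_pbound Rb3 _ _ _) (runs_skip_pbound _ _).
Qed.

Definition row0_cmd : cmd :=
  let dbl b := Seq (cell (xbit b)) (cell (xbit b)) in
  seqs [:: Loop Rb1 (cell xblank) (cell xblank); Loop Rx (dbl false) (dbl true);
           cell (xbit false); cell (xbit true);
           Loop Rm (cell xguess) (cell xguess); Loop Rb2 (cell xend) (cell xend);
           cell xblank].

Definition row0_store (x : seq bool) : store :=
  advance (row0 x) (put Rb3 (nseq (margin (size x)) true) store0).

Lemma runs_row0 : exists C e, forall x H, nvars (size x) <= H ->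
  runs row0_cmd (setup_store x) (pbound C e H) (row0_store x).
Proof.
have [C1 [e1 R1]] := @runs_cells Rb1 xblank isT.
have [C2 [e2 R2]] := runs_bits xbit.
have [C3 [e3 R3]] := runs_cell (xbit false).
have [C4 [e4 R4]] := runs_cell (xbit true).
have [C5 [e5 R5]] := @runs_cells Rm xguess isT.
have [C6 [e6 R6]] := @runs_cells Rb2 xend isT.
have [C7 [e7 R7]] := runs_cell xblank.
eexists; eexists => x H; set n := size x => nH.
have bH : (period n).*2 <= H by apply: leq_trans nH; rewrite leq_double leq_addr.
rewrite /period in bH.
set s0 := put Rb3 (nseq (margin n) true) store0.
pose m := nseq (witlen n) true; pose B := nseq (margin n) true.
pose g1 := nseq (margin n) xblank.
pose g2 := g1 ++ flatten [seq [:: xbit b; xbit b] | b <- x].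
pose g3 := g2 ++ [:: xbit false]; pose g4 := g3 ++ [:: xbit true].
pose g5 := g4 ++ nseq (witlen n) xguess; pose g6 := g5 ++ nseq (margin n) xend.
have sz1 : size g1 = margin n by rewrite size_nseq.
have sz2 : size g2 = margin n + n.*2.
  rewrite size_cat sz1; congr (_ + _); rewrite /n.
  by elim: (x) => //= b x' ->; lia.
have sz3 : size g3 = margin n + n.*2 + 1 by rewrite size_cat sz2.
have sz4 : size g4 = margin n + n.*2 + 1 + 1 by rewrite size_cat sz3.
have sz5 : size g5 = margin n + n.*2 + 1 + 1 + witlen n.
  by rewrite size_cat sz4 size_nseq.
have sz6 : size g6 = margin n + n.*2 + 1 + 1 + witlen n + margin n.
  by rewrite size_cat sz5 size_nseq.
pose st g l1 l2 l3 := put Rx l1 (put Rm l2 (put Rb2 l3 (advance g s0))).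
have -> : row0_store x = advance [:: xblank] (st g6 [::] [::] [::]).
  have rowE : row0 x = g6 ++ [:: xblank].
    by rewrite /g6 /g5 /g4 /g3 /g2 /row0 -!catA.
  by rewrite /row0_store rowE (advance_cat g6).
have RdE g l1 l2 l3 : get Rd (st g l1 l2 l3) = nseq (size g).*2 true.
  by rewrite -[RHS]cats0.
have stE g g' l1 l2 l3 : st (g ++ g') l1 l2 l3 = advance g' (st g l1 l2 l3).
  by rewrite /st advance_cat.
apply: (runs_seq_pbound (s2 := st g1 x m B)).
  rewrite [st _ _ _ _](_ : _ = put Rb1 [::] (advance g1 (setup_store x))) //.
  by apply: (R1 (setup_store x) H 0 (margin n)) => //; lia.
apply: (runs_seq_pbound (s2 := st g2 [::] m B)).
  rewrite /g2 stE.
  by apply: (R2 (st g1 x m B) H _ x _ (RdE _ _ _ _)) => //; rewrite -/n sz1; lia.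
apply: (runs_seq_pbound (s2 := st g3 [::] m B)).
  by rewrite /g3 stE; apply: (R3 _ H _ _ (RdE _ _ _ _)) => //; rewrite sz2; lia.
apply: (runs_seq_pbound (s2 := st g4 [::] m B)).
  by rewrite /g4 stE; apply: (R4 _ H _ _ (RdE _ _ _ _)) => //; rewrite sz3; lia.
apply: (runs_seq_pbound (s2 := st g5 [::] [::] B)).
  rewrite /g5 stE.
  by apply: (R5 (st g4 [::] m B) H _ (witlen n) _ (RdE _ _ _ _)) => //; rewrite sz4; lia.
apply: (runs_seq_pbound (s2 := st g6 [::] [::] [::])).
  rewrite /g6 stE.
  by apply: (R6 (st g5 [::] [::] B) H _ (margin n) _ (RdE _ _ _ _)) => //; rewrite sz5; lia.
apply: runs_seq_pbound _ (runs_skip_pbound _ _).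
by apply: (R7 _ H _ _ (RdE _ _ _ _)) => //; rewrite sz6; lia.
Qed.

(** The nested loops realise the product in [nwindows]. A loop consumes its counter, so the period
    in [Rw] is copied to [Rj] and restored from [Rt1]. *)
Definition windows_cmd : cmd :=
  let dup := Seq (Push Rj true) (Push Rt1 true) in
  let row := seqs [:: Loop Rw dup dup; Loop Rt1 (Push Rw true) (Push Rw true);
                      Loop Rj (slide xne xwin) (slide xne xwin)] in
  Loop Rb3 row row.

Definition windows_store (x : seq bool) : store :=
  put Rb3 [::] (slid xne xwin (nwindows (size x)) (row0_store x)).

Lemma runs_windows : exists C e, forall x H, nvars (size x) <= H ->
  runs windows_cmd (row0_store x) (pbound C e H) (windows_store x).
Proof.
have [C [e R]] := runs_slides xne xwin.
eexists; eexists => x H; set n := size x => nH.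
have nw : 2 * (nwindows n) + 2 * period n <= H by move: nH; rewrite /nvars; lia.
have mG : 2 < margin n by rewrite /margin; lia.
have pG : 2 < period n by rewrite /period; lia.
have mH : margin n <= H by move: nw; rewrite /period; lia.
have pH : period n <= H by lia.
set s0 := row0_store x; set D := period n in nw pG pH *.
pose G i j := put Rb3 (nseq i true) (slid xne xwin (j * D) s0).
have -> : windows_store x = G 0 (margin n) by [].
have s0E : s0 = G (margin n) 0.
  by rewrite /G mul0n slid0.
rewrite [X in runs _ X]s0E; apply: runs_for_pbound => // i j ijm.
rewrite put_put; set s1 := put Rb3 _ _.
have jH : (j.+1 * D).*2 + D.*2 <= H.
  suff : j.+1 * D <= nwindows n by lia.
  by apply: leq_mul => //; lia.
have Ew : get Rw s1 = nseq D true.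
  by rewrite /D -size_row0 -[RHS]cats0.
have Ed : get Rd s1 = nseq ((j * D).*2 + D.*2) true.
  have {2}-> : D = size (row0 x) by rewrite size_row0.
  by rewrite nseqD -[nseq (size (row0 x)).*2 true]cats0.
have Ep : get Rp s1 = nseq (j * D).*2 true by rewrite -[RHS]cats0.
have -> : G i j.+1 = put Rj [::] (slid xne xwin D (put Rj (nseq D true) s1)).
  by rewrite /G mulSn addnC slidD.
have [Ej E1 E2 Ef] : [/\ get Rj s1 = [::], get Rt1 s1 = [::],
  get Rt2 s1 = [::] & get Rf s1 = [::]] by [].
clearbody s1.
pose K i j := put Rw (nseq i true) (put Rj (nseq j true) (put Rt1 (nseq j true) s1)).
apply: (@runs_seq_pbound _ _ _ (K 0 D)).
  have -> : s1 = K D 0.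
    by case: s1 @K Ew Ej E1 {Ed Ep E2 Ef} => /= *; congr Store.
  apply: runs_for_pbound => // i' j' _.
  exact: runs_seq_pbound (runs_push_pbound _ _ _ _) (runs_push_pbound Rt1 _ _ _).
pose K' i j := put Rw (nseq j true) (put Rj (nseq D true) (put Rt1 (nseq i true) s1)).
apply: (@runs_seq_pbound _ _ (K' D 0) (K' 0 D)).
  apply: runs_for_pbound => // i' j' _; exact: (runs_push_pbound Rw).
apply: runs_seq_pbound _ (runs_skip_pbound _ _).
have -> : K' 0 D = put Rj (nseq D true) s1.
  by case: s1 @K @K' Ew Ej E1 {Ed Ep E2 Ef} => /= *; congr Store.
apply: (R (put Rj (nseq D true) s1) H _ _ D _ Ep Ed); try by []; try lia.
by apply/and3P; split; apply/eqP.
Qed.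

(** The header comes first in the encoding, but the numbers of variables and conjuncts are known
    only at the end. The body is therefore parked in [Rx] and put back afterwards, the two reversals
    cancelling. By then [Rd] equals the number of variables and pays for one bound 4 each. *)
Definition header_cmd : cmd :=
  seqs [:: Loop Rbody (Push Rx false) (Push Rx true);
           emit (TC sigma); emit (TR Rd 0);
           Loop Rd (emit (TC 4)) (emit (TC 4)); emit (TR Rc 0);
           Loop Rx (Push Rbody false) (Push Rbody true)].

Lemma runs_header : exists C e, forall s H N F b,
  scratch s -> get Rx s = [::] -> get Rd s = nseq N true ->
  get Rc s = nseq F true -> get Rbody s = rev b ->
  N <= H -> F <= H -> size b <= H ->
  exists2 s', runs header_cmd s (pbound C e H) s' &
    rev (get Rbody s') = enc_nats ([:: sigma, N & nseq N 4] ++ [:: F]) ++ b.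
Proof.
have [C1 [e1 R1]] := runs_emit (TC sigma).
have [C2 [e2 R2]] := runs_emit (TR Rd 0).
have [C3 [e3 R3]] := runs_emit (TC 4).
have [C4 [e4 R4]] := runs_emit (TR Rc 0).
eexists; eexists => s H N F b sc Ex Ed Ec Eb NH FH bH.
have move_le r r' s' : r != r' -> size (get r s') <= H ->
    runs (Loop r (Push r' false) (Push r' true)) s' (pbound 2 1 H)
      (put r [::] (put r' (rev (get r s') ++ get r' s') s')).
  move=> rr' rH; apply: runs_weaken (runs_move s' rr').
  by rewrite /pbound expn1; lia.
pose s1 := put Rbody [::] (put Rx b s).
pose h1 := enc_nat sigma; pose h2 := h1 ++ enc_nat N.
pose h3 j := h2 ++ enc_nats (nseq j 4); pose h4 := h3 N ++ enc_nat F.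
pose s2 := put Rd [::] (put Rbody (rev h4) s1).
exists (put Rx [::] (put Rbody (rev b ++ rev h4) s2)); last first.
  rewrite -[get Rbody _]/(rev b ++ rev h4) -rev_cat revK /h4 /h3 /h2 /h1.
  by rewrite /enc_nats map_cat flatten_cat /= cats0 -!catA.
have addh h h' s' : get Rbody s' = rev h ->
    put Rbody (rev (h ++ h')) s' = put Rbody (rev h' ++ get Rbody s') s'.
  by move=> ->; rewrite rev_cat.
apply: (runs_seq_pbound (s2 := s1)).
  have -> : s1 = put Rbody [::] (put Rx (rev (get Rbody s) ++ get Rx s) s).
    by rewrite Eb revK Ex cats0.
  by apply: move_le; rewrite // Eb size_rev.
apply: (runs_seq_pbound (s2 := put Rbody (rev h1) s1)).
  have := R1 s1 H sc isT; rewrite -[get Rbody s1]/[::] cats0; exact.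
apply: (runs_seq_pbound (s2 := put Rbody (rev h2) s1)).
  have tk : tok_ok H (put Rbody (rev h1) s1) (TR Rd 0).
    by rewrite /tok_ok -[get Rd _]/(get Rd s) Ed size_nseq eqxx NH.
  have := R2 (put Rbody (rev h1) s1) H sc tk.
  have -> : tokval (put Rbody (rev h1) s1) (TR Rd 0) = N.
    by rewrite /tokval -[get Rd _]/(get Rd s) Ed size_nseq.
  rewrite -(addh h1) //; exact.
pose G i j := put Rd (nseq i true) (put Rbody (rev (h3 j)) s1).
have -> : put Rbody (rev h2) s1 = G N 0.
  have -> : G N 0 = put Rd (get Rd (put Rbody (rev h2) s1)) (put Rbody (rev h2) s1).
    by rewrite -[get Rd (put _ _ _)]/(get Rd s) Ed /G /h3 [_ ++ _]cats0.
  by rewrite put_get.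
apply: (@runs_seq_pbound _ _ (G N 0) (G 0 N)).
  apply: runs_for_pbound => // i j _.
  have := R3 (put Rd (nseq i true) (G i.+1 j)) H sc isT.
  have -> : tokval (put Rd (nseq i true) (G i.+1 j)) (TC 4) = 4 by [].
  have h3S : h3 j ++ enc_nat 4 = h3 j.+1.
    rewrite /h3 -catA -[j.+1]addn1 nseqD /enc_nats map_cat flatten_cat.
    by rewrite -[enc_nat 4]cats0.
  rewrite -(addh (h3 j)) // h3S; exact.
apply: (runs_seq_pbound (s2 := s2)).
  have tk : tok_ok H (G 0 N) (TR Rc 0).
    by rewrite /tok_ok -[get Rc _]/(get Rc s) Ec size_nseq eqxx FH.
  have := R4 (G 0 N) H sc tk.
  have -> : tokval (G 0 N) (TR Rc 0) = F.
    by rewrite /tokval -[get Rc _]/(get Rc s) Ec size_nseq.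
  rewrite -(addh (h3 N)) //; exact.
by apply: runs_seq_pbound (move_le Rx Rbody s2 isT bH) (runs_skip_pbound _ _).
Qed.

Definition generator : cmd :=
  seqs [:: setup_cmd; row0_cmd; windows_cmd; header_cmd].

Lemma poly_nvars : poly nvars.
Proof.
have dbl f : poly f -> poly (fun n => (f n).*2).
  by move=> pf; have [C [e E]] := polyD pf pf; exists C, e => n; rewrite -addnn.
have pw : poly witlen by exists c1, k1.
have pm : poly margin.
  apply: polyD (polyC 3); apply: poly_pbound; apply: polyD pw.
  by apply: polyD (polyC 2); apply: dbl poly_id.
have pp : poly period.
  apply: polyD (dbl _ pm); apply: polyD pw.
  by apply: polyD (polyC 3); apply: dbl poly_id.
exact/dbl/(polyD pp)/polyM.
Qed.

Lemma ser_reduction x : encode_instance (reduction x) =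
  enc_nats ([:: sigma, nvars (size x) & nseq (nvars (size x)) 4]
    ++ [:: size (inst_formula (reduction x))])
  ++ enc_nats (flatten (map ser_bexp (inst_formula (reduction x)))).
Proof.
rewrite /encode_instance /ser_instance /enc_nats -flatten_cat -map_cat -catA.
by rewrite size_nseq.
Qed.

Lemma generator_spec : exists U, poly U /\ forall x, exists u s',
  [/\ u <= U (size x),
      iter u cstep ([:: generator], put Rin (rev x) store0) = ([::], s') &
      rev (get Rbody s') = encode_instance (reduction x)].
Proof.
have [C1 [e1 R1]] := runs_setup; have [C2 [e2 R2]] := runs_row0.
have [C3 [e3 R3]] := runs_windows; have [C4 [e4 R4]] := runs_header.
pose T n := pbound C1 e1 (nvars n) + pbound C2 e2 (nvars n) + pbound C3 e3 (nvars n).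
(* The header phase moves the whole body, whose length is at most the time spent before it. *)
pose T' n := pbound C4 e4 (n + T n).
exists (fun n => T n + T' n + 10); split.
  have pN C e : poly (fun n => pbound C e (nvars n)) := poly_pbound C e poly_nvars.
  have pT : poly T by exact: polyD (polyD (pN _ _) (pN _ _)) (pN _ _).
  exact: polyD (polyD pT (poly_pbound _ _ (polyD poly_id pT))) (polyC 10).
move=> x; set n := size x; set N := nvars n.
have S1 := R1 x N (leqnn _); have S2 := R2 x N (leqnn _); have S3 := R3 x N (leqnn _).
have szs r : size (get r (windows_store x)) <= n + T n.
  rewrite /T !addnA; apply: (runs_size S3); apply: (runs_size S2); apply: (runs_size S1).
  by move=> r'; rewrite get_put get_store0; case: eqP; rewrite ?size_rev.
have Fsz := szs Rc; have Bsz := szs Rbody; have Dsz := szs Rd.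
set f := inst_formula (reduction x).
have fE : f = cells 0 (row0 x)
    ++ windows xne xwin (nwindows n) 0 (size (nseq (size (row0 x)).*2 true ++ [::])).
  by rewrite cats0 size_nseq size_row0.
have Eb : get Rbody (windows_store x) = rev (enc_nats (flatten (map ser_bexp f))).
  rewrite fE map_cat flatten_cat /enc_nats map_cat flatten_cat rev_cat.
  by rewrite -[X in _ ++ X]cats0.
have Ec : get Rc (windows_store x) = nseq (size f) true.
  by rewrite fE size_cat addnC nseqD -[X in _ ++ X]cats0.
have Ed : get Rd (windows_store x) = nseq N true.
  rewrite /N /nvars doubleD addnC nseqD -[X in _ ++ X]cats0.
  by rewrite -/n /n -size_row0.
rewrite Ec Ed Eb size_rev !size_nseq in Fsz Dsz Bsz.
have [s' S4 E'] :=
  R4 (windows_store x) (n + T n) N (size f) _ isT erefl Ed Ec Eb Dsz Fsz Bsz.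
have Rg : runs generator (put Rin (rev x) store0) (T n + T' n + 10) s'.
  apply: runs_seq S1 _ _; first apply: runs_seq S2 _ _; first apply: runs_seq S3 _ _.
  - exact: runs_seq S4 (runs_skip _) (ltnSn _).
  - exact: ltnSn.
  - exact: ltnSn.
  - rewrite -/(T' n); set Z := T' n; rewrite /T -/N; lia.
have [u uT E] := Rg [::]; exists u, s'; split=> //.
by rewrite E' ser_reduction.
Qed.

Lemma reduction_poly_computable :
  poly_computable (fun x => encode_instance (reduction x)).
Proof.
have [U [pU G]] := generator_spec.
have [C [e E]] : poly (fun n => U n * (2 * (n + U n) + 3) + 1).
  apply: polyD (polyM pU (polyD _ (polyC 3))) (polyC 1).
  exact: polyM (polyC 2) (polyD poly_id pU).
exists (cmdTM generator), C, e => x; have [u [s' [uU I O]]] := G x.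
have [t tu [H1 H2]] := cmdTM_run I; exists t; split; last by rewrite H2 O.
apply: leq_trans (E (size x)); apply: leq_trans tu _; rewrite addn1 ltnS.
by apply: leq_mul => //; lia.
Qed.

End Generator.

(** * Tilings as string constraints *)

Lemma eval_formula_cat asg f1 f2 :
  eval_formula asg (f1 ++ f2) <-> eval_formula asg f1 /\ eval_formula asg f2.
Proof. by elim: f1 => [|e f1 IH] /=; [|rewrite IH]; tauto. Qed.

Lemma eval_excl asg ws v : eval_formula asg (excl ws v) <-> asg v \notin ws.
Proof.
elim: ws => //= w ws; rewrite /eval_formula /= => ->.
by rewrite inE negb_or; split=> [[/eqP-> ->]//|/andP[/eqP]].
Qed.

Lemma eval_cells asg i gs : eval_formula asg (cells i gs) <->
  forall j, j < size gs -> asg (i + j.*2) \notin nth [::] gs j.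
Proof.
elim: gs i => [|ws gs IH] i //=; rewrite eval_formula_cat eval_excl IH; split.
  move=> [H0 H] [|j] jl; first by rewrite addn0.
  by rewrite doubleS -!addSnnS; apply: H.
move=> H; split=> [|j jl]; first by rewrite -[i]addn0; apply: (H 0).
by rewrite !addSnnS -doubleS; apply: (H j.+1).
Qed.

Lemma eval_windows asg xne xwin n p d :
  eval_formula asg (windows xne xwin n p d) <->
  forall j, j < n -> eval_formula asg (window xne xwin (p + j.*2) (d + j.*2)).
Proof.
elim: n p d => [|n IH] p d //.
rewrite -[windows _ _ _ _ _]/(window _ _ _ _ ++ windows _ _ _ _ _).
rewrite eval_formula_cat IH.
split=> [[H0 H] [|j] jl|H]; first by rewrite !addn0.
  by rewrite doubleS -!addSnnS; apply: H.
split=> [|j jl]; first by rewrite -[p]addn0 -[d]addn0; apply: (H 0).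
by rewrite !addSnnS -doubleS; apply: (H j.+1).
Qed.

Fixpoint words (sigma k : nat) : seq (seq nat) :=
  if k is k'.+1 then [seq a :: w | a <- iota 0 sigma, w <- words sigma k']
  else [:: [::]].

Lemma mem_words sigma k w :
  (w \in words sigma k) = (size w == k) && all (fun c => c < sigma) w.
Proof.
elim: k w => [|k IH] [|a w] //=; first by apply/allpairsP=> -[[? ?] []].
rewrite eqSS [(a < _) && _]andbC andbA -IH.
apply/allpairsP/andP=> [[[b w'] [/= bs ww [-> ->]]]|[ww al]].
  by move: bs; rewrite mem_iota.
by exists (a, w); rewrite mem_iota.
Qed.

(* The words of length at most 4 (the length bound of every variable) that
   violate [g]. *)
Definition bad_words (sigma : nat) (g : pred (seq nat)) : seq (seq nat) :=
  [seq w <- flatten [seq words sigma k | k <- iota 0 5] | ~~ g w].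

Lemma mem_bad_words sigma g w : size w <= 4 -> all (fun c => c < sigma) w ->
  (w \in bad_words sigma g) = ~~ g w.
Proof.
move=> sz al; rewrite mem_filter; case: (g w) => //; rewrite andTb.
apply/flatten_mapP; exists (size w); first by rewrite mem_iota.
by rewrite mem_words eqxx.
Qed.

Lemma bad_words_letters sigma g w : w \in bad_words sigma g ->
  all (fun c => c < sigma) w.
Proof.
by rewrite mem_filter => /andP[_ /flatten_mapP[k _]]; rewrite mem_words => /andP[].
Qed.

Lemma contains_at1 s i a : contains_at s i.+1 [:: a] <->
  i < size s /\ nth 0 s i = a.
Proof.
split=> [[_ [u [v [-> /= <-]]]]|[il <-]].
  by rewrite size_cat /= nth_cat ltnn subnn; split=> //; lia.
split=> //; exists (take i s), (drop i.+1 s); rewrite size_takel 1?ltnW //.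
by rewrite /= -drop_nth // cat_take_drop.
Qed.

Section Tiling.

Variables (L : finType) (x0 : L).

Definition code (a : L) : nat := index a (enum L).
Definition decode (n : nat) : L := nth x0 (enum L) n.

Lemma codeK : cancel code decode.
Proof. by move=> a; rewrite /decode /code nth_index ?mem_enum. Qed.

Lemma code_lt a : code a < #|L|.
Proof. by rewrite cardE index_mem mem_enum. Qed.

Lemma decodeK n : n < #|L| -> code (decode n) = n.
Proof. by rewrite cardE => nL; rewrite /code /decode index_uniq ?enum_uniq. Qed.

Definition one (g : pred L) (w : seq nat) : bool :=
  if w is [:: a] then g (decode a) else false.

Definition four (ok : L -> L -> L -> pred L) (w : seq nat) : bool :=
  if w is [:: a; b; c; d] then ok (decode a) (decode b) (decode c) (decode d)
  else false.

Definition bad_cell g := bad_words #|L| (one g).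
Definition bad_window ok := bad_words #|L| (four ok).
Definition bad_empty := bad_words #|L| (fun w => w != [::]).

Definition tiling_instance (gs : seq (pred L)) (ok : L -> L -> L -> pred L)
    (K : nat) : instance :=
  Instance #|L|
    (cells 0 (map bad_cell gs)
     ++ windows bad_empty (bad_window ok) K 0 (size gs).*2)
    (nseq (size gs + K).*2 4).

Lemma tiling_wf gs ok K : 2 < size gs -> wf_instance (tiling_instance gs ok K).
Proof.
move=> D3; set I := tiling_instance _ _ _.
have wf_excl g v : v < (size gs + K).*2 ->
    all (wf_bexp I) (excl (bad_words #|L| g) v).
  move=> vN; rewrite all_map; apply/allP=> w /bad_words_letters wl /=.
  by rewrite size_nseq vN.
have wf_cells gs' i : i + (size gs').*2 <= (size gs + K).*2 ->
    all (wf_bexp I) (cells i (map bad_cell gs')).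
  elim: gs' i => [//|g gs' IH] i il; rewrite [size _]/= in il.
  rewrite -[cells _ _]/(excl (bad_cell g) i ++ cells i.+2 (map bad_cell gs')).
  rewrite all_cat wf_excl ?IH //; lia.
have wf_windows n p d :
    p + n.*2 + 4 <= (size gs + K).*2 -> d + n.*2 <= (size gs + K).*2 ->
    all (wf_bexp I) (windows bad_empty (bad_window ok) n p d).
  elim: n p d => [//|n IH] p d pN dN.
  rewrite -[windows _ _ _ _ _]/(window bad_empty (bad_window ok) p d
    ++ windows bad_empty (bad_window ok) n p.+2 d.+2).
  rewrite /window !all_cat !wf_excl ?IH ?andbT /= ?size_nseq; lia.
by rewrite /wf_instance all_cat wf_cells ?wf_windows //; lia.
Qed.

Lemma tiling_instanceP gs ok K : 2 < size gs ->
  satisfiable (tiling_instance gs ok K) <->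
  exists S : nat -> L,
    (forall i, i < size gs -> nth xpred0 gs i (S i)) /\
    (forall p, p < K -> ok (S p) (S p.+1) (S p.+2) (S (p + size gs))).
Proof.
move=> D3; set D := size gs in D3 *; pose N := (D + K).*2; split; last first.
  case=> S [Sg Sok].
  pose win p := [:: code (S p); code (S p.+1); code (S p.+2); code (S (p + D))].
  pose asg v := if odd v then win v./2 else [:: code (S v./2)].
  have asg0 j : asg j.*2 = [:: code (S j)] by rewrite /asg odd_double doubleK.
  have asg1 j : asg j.*2.+1 = win j by rewrite /asg /= odd_double uphalf_double.
  have asg_ok v : all (fun c => c < #|L|) (asg v) /\ size (asg v) <= 4.
    by rewrite /asg; case: (odd v); rewrite /= !code_lt.
  have notin g v : asg v \notin bad_words #|L| g <-> g (asg v).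
    by have [al sz] := asg_ok v; rewrite mem_bad_words // negbK.
  exists asg; split.
    move=> v; rewrite /= size_nseq => vN; rewrite nth_nseq vN; exact: asg_ok.
  rewrite /= eval_formula_cat eval_cells eval_windows size_map; split.
    move=> j jD; rewrite (nth_map xpred0) // notin add0n asg0 /= codeK; exact: Sg.
  move=> j jK; rewrite add0n -doubleD /window eval_formula_cat; split.
    by rewrite /= -!doubleS !asg0 asg1 !contains_at1 /win addnC.
  rewrite eval_formula_cat !eval_excl !notin asg0 asg1; split=> //.
  by rewrite /four /win !codeK; apply: Sok.
case=> asg [adm]; rewrite /= eval_formula_cat eval_cells eval_windows size_map.
move=> [Hc Hw].
have asg_ok v : v < N -> all (fun c => c < #|L|) (asg v) /\ size (asg v) <= 4.
  by move=> vN; have := adm v; rewrite /= size_nseq nth_nseq vN; apply.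
have notin g v : v < N -> asg v \notin bad_words #|L| g -> g (asg v).
  by move=> vN; have [al sz] := asg_ok v vN; rewrite mem_bad_words // negbK.
(* The default [0] never shows for [i < D + K], where [sing] finds one-letter words. *)
pose S i := decode (head 0 (asg i.*2)).
have win j : j < K -> exists a b c d,
   [/\ asg j.*2.+1 = [:: a; b; c; d], ok (decode a) (decode b) (decode c) (decode d) &
       [/\ asg (j + D).*2 <> [::],
        contains_at [:: a; b; c; d] 1 (asg j.*2),
        contains_at [:: a; b; c; d] 2 (asg j.+1.*2),
        contains_at [:: a; b; c; d] 3 (asg j.+2.*2) &
        contains_at [:: a; b; c; d] 4 (asg (j + D).*2)]].
  move=> jK; have := Hw j jK; rewrite add0n -doubleD [D + j]addnC /window eval_formula_cat.
  rewrite eval_formula_cat !eval_excl => -[/= [c1 [c2 [c3 [c4 _]]]] [/notin ne /notin]].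
  have jN : j.*2.+1 < N by rewrite /N; lia.
  move=> /(_ jN); case: (asg j.*2.+1) c1 c2 c3 c4 => // a [|b [|c [|d []]]] //.
  move=> c1 c2 c3 c4 okj; exists a, b, c, d; split=> //; split=> //.
  by apply/eqP/ne; rewrite /N; lia.
(* On the first [D] cells [one] admits only one-letter words. A later cell occurs at position 4 of a
   four-letter word, which leaves at most one letter, and [bad_empty] rules out none. *)
have sing i : i < D + K -> asg i.*2 = [:: code (S i)].
  have unit_word a : i < D + K -> asg i.*2 = [:: a] -> asg i.*2 = [:: code (S i)].
    move=> iDK E; rewrite /S E /= decodeK //.
    have iN : i.*2 < N by rewrite /N; lia.
    by have [] := asg_ok _ iN; rewrite E /= andbT.
  move=> iDK; have [iD|Di] := ltnP i D.
    have iN : i.*2 < N by rewrite /N; lia.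
    have := Hc i iD; rewrite (nth_map xpred0) // add0n => /(notin _ _ iN).
    by rewrite /one; case E: (asg i.*2) => [|a []] // _; rewrite -E; exact: (unit_word a).
  have jK : i - D < K by lia.
  have [a [b [c [d [_ _ [ne _ _ _ [_ [u [v [E szu]]]]]]]]]] := win _ jK.
  rewrite subnK // in ne E.
  case: u szu E => [|? [|? [|? []]]] //= _ [_ _ _ E].
  case Ei : (asg i.*2) ne E => [|d' [|]] // _ [_ _].
  by rewrite -Ei; apply: (unit_word d').
exists S; split.
  move=> i iD; have iN : i.*2 < N by rewrite /N; lia.
  have := Hc i iD; rewrite (nth_map xpred0) // add0n => /(notin _ _ iN).
  by rewrite sing /= ?codeK //; lia.
move=> p pK; have [a [b [c [d [_ okp [_]]]]]] := win p pK.
rewrite !sing; try lia.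
rewrite !contains_at1 /= => -[_ Ea] [_ Eb] [_ Ec] [_ Ed].
by move: okp; rewrite Ea Eb Ec Ed !codeK.
Qed.

End Tiling.

(** * Computations as tilings *)

Section Tableau.

Variable M : TM.

(* [inl _]: input letters of the first row, [None] being the end marker;
   [inr (inl a)]: a tape cell away from the head; [inr (inr (q, a))]: the cell
   under the head, in state [q]. *)
Definition letter := (option bool + (tm_sym M + tm_state M * tm_sym M))%type.

Definition plain (a : tm_sym M) : letter := inr (inl a).
Definition under (q : tm_state M) (a : tm_sym M) : letter := inr (inr (q, a)).

Definition action (a : letter) : option (tm_state M * tm_sym M * move) :=
  if a is inr (inr (q, s)) then
    if tm_halt M q then None else Some (tm_delta M q s)
  else None.

(** One row turns the raw input into the initial configuration: the first input letter is recognised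
    by its non-input left neighbour and receives the start state. A halted head has no action, so
    halted rows repeat. *)
Definition rule (a b c : letter) : letter :=
  match b with
  | inl None => plain (tm_blank M)
  | inl (Some x) =>
      if a is inl _ then plain (tm_in M x) else under (tm_start M) (tm_in M x)
  | inr (inl s) =>
      match action c, action a with
      | Some (q, _, MLeft), _ => under q s
      | _, Some (q, _, MRight) => under q s
      | _, _ => b
      end
  | inr (inr _) =>
      match action b with
      | Some (q, s, MStay) => under q s
      | Some (q, s, _) => plain s
      | None => b
      end
  end.

(** Forces the free stretch to be a word followed by end markers, so that shorter witnesses are
    represented too. *)
Definition input_after_end (b c : letter) : bool :=
  if (b, c) is (inl None, inl (Some _)) then true else false.

Definition rejecting (b : letter) : bool :=
  if b is inr (inr (q, _)) then tm_halt M q && ~~ tm_accept M q else false.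

Definition tile_ok (a b c d : letter) : bool :=
  [&& d == rule a b c, ~~ input_after_end b c & ~~ rejecting b].

(** Tapes carry no absolute positions, so the column of the head is tracked beside the run. In the
    runs considered [pos_bounds] keeps it at 3 or more, so [h.-1] is never truncated. *)
Definition next_pos (h : nat) (c : config M) : nat :=
  if action (under c.1 c.2.1.2) is Some (_, _, m) then
    match m with MLeft => h.-1 | MRight => h.+1 | MStay => h end
  else h.

Definition sym_at (h : nat) (c : config M) (j : nat) : tm_sym M :=
  let: (_, (l, a, r)) := c in
  if j < h then nth (tm_blank M) l (h - j.+1)
  else if j == h then a else nth (tm_blank M) r (j - h.+1).

Definition letter_at (h : nat) (c : config M) (j : nat) : letter :=
  if j == h then under c.1 (sym_at h c j) else plain (sym_at h c j).

Lemma sym_at_step h c j : 0 < h -> j != h ->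
  sym_at (next_pos h c) (step M c) j = sym_at h c j.
Proof.
case: c => q [[l a] r] h0 jh; rewrite /next_pos /step /=.
case: (tm_halt M q) => //; case: (tm_delta M q a) => [[q' b] []] /=.
- case: l => [|b' l] /=; case: (ltngtP j h) jh => // [jlt|jgt] _.
  + rewrite !nth_nil; case: ltnP => // jl.
    by have -> : (j == h.-1) = true by lia.
  + have -> : (j < h.-1) = false by lia.
    have -> : (j == h.-1) = false by lia.
    by have -> : j - h.-1.+1 = (j - h.+1).+1 by lia.
  + case: ltnP => [jl|jl]; first by have -> : h - j.+1 = (h.-1 - j.+1).+1 by lia.
    have -> : j = h.-1 by lia.
    by rewrite eqxx (_ : h - h.-1.+1 = 0) //; lia.
  + have -> : (j < h.-1) = false by lia.
    have -> : (j == h.-1) = false by lia.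
    by have -> : j - h.-1.+1 = (j - h.+1).+1 by lia.
- case: r => [|b' r] /=; case: (ltngtP j h) jh => // [jlt|jgt] _.
  + by rewrite ltnS ltnW // subSn.
  + rewrite ltnS leqNgt jgt /=; case: eqP => _; by rewrite !nth_nil.
  + by rewrite ltnS ltnW // subSn.
  + rewrite ltnS leqNgt jgt /=; case: eqP => [->|jE]; first by rewrite subnn.
    by have -> : j - h.+1 = (j - h.+2).+1 by lia.
- by case: (ltngtP j h) jh.
Qed.

Lemma sym_at_head h c : sym_at h c h = c.2.1.2.
Proof. by case: c => q [[l a] r]; rewrite /sym_at ltnn eqxx. Qed.

Lemma sym_at_step_head h c : 0 < h ->
  sym_at (next_pos h c) (step M c) h =
  if action (under c.1 c.2.1.2) is Some (_, s, _) then s else c.2.1.2.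
Proof.
case: c => q [[l a] r] h0; rewrite /next_pos /step /=.
case: (tm_halt M q) => /=; first by rewrite ltnn eqxx.
case: (tm_delta M q a) => [[q' b] []] /=; last by rewrite ltnn eqxx.
- have nlt : (h < h.-1) = false by lia.
  have neq : (h == h.-1) = false by lia.
  by case: l => [|b' l] /=; rewrite nlt neq (_ : h - h.-1.+1 = 0) //; lia.
- by case: r => [|b' r] /=; rewrite ltnSn subnn.
Qed.

(** Only the letter under the head can have an action, which leaves four cases: head at [j], just
    right of it, just left of it, or elsewhere. *)
Lemma letter_at_step h c j : 0 < h -> 0 < j ->
  letter_at (next_pos h c) (step M c) j =
  rule (letter_at h c j.-1) (letter_at h c j) (letter_at h c j.+1).
Proof.
move=> h0 j0; rewrite {1}/letter_at.
have stepq : (step M c).1 = if action (under c.1 c.2.1.2) is Some (q, _, _) then q else c.1.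
  case: c => q [[l a] r] /=; case: (tm_halt M q) => //.
  by case: (tm_delta M q a) => [[]].
have act_far i : i != h -> action (letter_at h c i) = None.
  by rewrite /letter_at => /negPf ->.
have act_head : action (letter_at h c h) = action (under c.1 c.2.1.2).
  by rewrite /letter_at eqxx sym_at_head.
have [->|jh] := eqVneq j h.
  rewrite sym_at_step_head // stepq {2}/letter_at eqxx sym_at_head.
  rewrite /rule /under -/(under _ _).
  rewrite /next_pos; case: (action _) => [[[q s] []]|]; rewrite ?eqxx //=.
    by have -> : (h == h.-1) = false by lia.
  by have -> : (h == h.+1) = false by lia.
rewrite sym_at_step // stepq [letter_at h c j]/letter_at (negPf jh) /rule {2}/plain.
have [jE|jN] := eqVneq j.+1 h.
  rewrite jE act_head act_far; last by lia.
  rewrite /next_pos -jE.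
  case: (action _) => [[[q s] []]|]; rewrite ?eqxx //=.
  - by have -> : (j == j.+2) = false by lia.
  - by have -> : (j == j.+1) = false by lia.
  - by have -> : (j == j.+1) = false by lia.
rewrite (act_far j.+1) //.
have [jE|jN'] := eqVneq j.-1 h.
  rewrite jE act_head; have -> : j = h.+1 by lia.
  rewrite /next_pos; case: (action _) => [[[q s] []]|]; rewrite ?eqxx //=.
  - by have -> : (h.+1 == h.-1) = false by lia.
  - by have -> : (h.+1 == h) = false by lia.
  - by have -> : (h.+1 == h) = false by lia.
rewrite act_far //.
have -> // : (j == next_pos h c) = false.
by rewrite /next_pos; case: (action _) => [[[q s] []]|]; lia.
Qed.

(** * The tableau of a halting run *)

Definition first_row (B : nat) (y : seq bool) (j : nat) : letter :=
  if j < B then plain (tm_blank M) else inl (onth y (j - B)).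

Fixpoint pos (B : nat) (y : seq bool) (t : nat) : nat :=
  if t is t'.+1 then next_pos (pos B y t') (run M t' y) else B.

(** Row 0 is the raw input, so configuration [t] stands in row [t.+1]. *)
Definition tab_cell (B : nat) (y : seq bool) (t j : nat) : letter :=
  if t is t'.+1 then letter_at (pos B y t') (run M t' y) j
  else first_row B y j.

Lemma sym_at_init B y j : sym_at B (init_config M y) j =
  if j < B then tm_blank M else nth (tm_blank M) (map (tm_in M) y) (j - B).
Proof.
rewrite /init_config; case: y => [|b y] /=; case: (ltngtP j B) => [_|jB|->];
  rewrite ?nth_nil ?subnn //.
by have -> : j - B = (j - B.+1).+1 by lia.
Qed.

(** The start state is attached to the first input letter, hence [y != [::]]; [pair_bits] never
    returns the empty word. *)
Lemma first_row_step B y j : 0 < B -> 0 < j -> y != [::] ->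
  letter_at B (init_config M y) j =
  rule (first_row B y j.-1) (first_row B y j) (first_row B y j.+1).
Proof.
move=> B0 j0 y0; rewrite /letter_at sym_at_init /first_row.
case: (ltngtP j B) => [jB|jB|->].
- have -> : j.-1 < B by lia.
  by rewrite /=; case: (j.+1 < B).
- have -> : (j.-1 < B) = false by lia.
  have [jy|yj] := ltnP (j - B) (size y).
    rewrite (nth_map false) //.
    have -> // : onth y (j - B) = Some (nth false y (j - B)).
    by rewrite onthE (nth_map false).
  by rewrite nth_default ?size_map // [onth y (j - B)]onth_default.
- have -> : B.-1 < B by lia.
  by rewrite subnn; case: y y0.
Qed.

Lemma first_row_end B y j : B + size y <= j -> first_row B y j = inl None.
Proof.
move=> le; rewrite /first_row ltnNge (leq_trans _ le) ?leq_addr //=.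
by rewrite onth_default //; lia.
Qed.

Lemma div_ind W (Q : nat -> Prop) : 0 < W ->
  (forall t j, j < W -> Q (t * W + j)) -> forall i, Q i.
Proof. by move=> W0 H i; rewrite (divn_eq i W); apply: H; rewrite ltn_pmod. Qed.

Section Halting.

Variables (B T : nat) (y : seq bool).
Hypotheses (y0 : y != [::]) (TB : T + 3 <= B).
Hypothesis haltT : tm_halt M (run M T y).1.

Lemma run_halted k : run M (T + k) y = run M T y.
Proof.
elim: k => [|k IH]; first by rewrite addn0.
rewrite addnS [run _ _ _]/(step M (run M (T + k) y)) IH.
by case: (run M T y) haltT => q [[l a] r] /= ->.
Qed.

Lemma pos_halted k : pos B y (T + k) = pos B y T.
Proof.
elim: k => [|k IH]; first by rewrite addn0.
by rewrite addnS /= run_halted IH /next_pos /= haltT.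
Qed.

(** The head moves at most one column per step and stays put after halting, so [T + 3 <= B] leaves
    three columns that it never visits. *)
Lemma pos_bounds t : (3 <= pos B y t) && (pos B y t <= B + T).
Proof.
have near k : (B <= pos B y k + k) && (pos B y k <= B + k).
  elim: k => [|k IH] /=; first by lia.
  by rewrite /next_pos; case: (action _) => [[[q s] []]|]; lia.
have [tT|Tt] := leqP t T; first by have := near t; lia.
by rewrite -(subnKC (ltnW Tt)) pos_halted; have := near T; lia.
Qed.

Lemma tab_cell_step t j : 0 < j ->
  tab_cell B y t.+1 j =
  rule (tab_cell B y t j.-1) (tab_cell B y t j) (tab_cell B y t j.+1).
Proof.
move=> j0; case: t => [|t]; first by apply: first_row_step => //=; lia.
by apply: (@letter_at_step (pos B y t)) => //; have := pos_bounds t; lia.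
Qed.

(** These columns are blank initially and out of reach of the head. They are the ones met by windows
    that straddle two rows. *)
Lemma tab_cell_blank t j : j < 3 \/ B + T < j /\ B + size y <= j ->
  tab_cell B y t.+1 j = plain (tm_blank M).
Proof.
move=> far; have jpos k : j != pos B y k.
  by apply/eqP=> jE; have := pos_bounds k; rewrite -jE; lia.
rewrite /tab_cell /letter_at (negPf (jpos t)); congr plain.
elim: t => [|t IH].
  rewrite sym_at_init /=; case: ltnP => // Bj.
  by rewrite nth_default // size_map; lia.
have h0 : 0 < pos B y t by have := pos_bounds t; lia.
by rewrite (@sym_at_step (pos B y t) (run M t y)) ?IH.
Qed.

Variable W : nat.
Hypothesis WB : B + maxn (size y) T.+1 + 2 <= W.

Definition tableau (i : nat) : letter := tab_cell B y (i %/ W) (i %% W).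

Lemma tableauE t j : j < W -> tableau (t * W + j) = tab_cell B y t j.
Proof.
move=> jW; rewrite /tableau divnMDl ?modnMDl; last by lia.
by rewrite divn_small // modn_small // addn0.
Qed.

Lemma tableau_step p :
  tableau (p + W.+1) = rule (tableau p) (tableau p.+1) (tableau p.+2).
Proof.
(* [q] is the middle of the window, and the rule describes the letter one row below it. *)
suff H q : 0 < q ->
    tableau (q + W) = rule (tableau q.-1) (tableau q) (tableau q.+1).
  by rewrite addnS -addSn H.
move: q; apply: (@div_ind W) => [|t j jW q0]; first by lia.
have -> : t * W + j + W = t.+1 * W + j by rewrite mulSn; lia.
rewrite [LHS]tableauE // (tableauE t jW).
(* Column 0: the left neighbour is the end of the previous row, a blank or, in row 0, an end marker;
   neither has an action. *)
case: j jW q0 => [|j] jW q0.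
  case: t q0 => [|t] q0; first by rewrite addn0 in q0.
  have -> : (t.+1 * W + 0).-1 = t * W + W.-1 by rewrite mulSn; lia.
  rewrite -addnS !tableauE; try lia.
  rewrite !tab_cell_blank; try by left.
  case: t {q0} => [|t]; first by rewrite /tab_cell first_row_end //; lia.
  by rewrite tab_cell_blank //; right; lia.
have -> : (t * W + j.+1).-1 = t * W + j by rewrite addnS.
rewrite (@tableauE t j) ?(ltnW jW) // -addnS.
(* Last column: the right neighbour is the start of the next row. The [+ 2] in [WB] makes the last
   two columns blank, or end markers in row 0. *)
have [jW'|Wj] := ltnP j.+2 W; first by rewrite tableauE // tab_cell_step.
have jE : j.+2 = W by lia.
have -> : t * W + j.+2 = t.+1 * W + 0 by rewrite mulSn; lia.
rewrite tableauE; last by lia.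
rewrite (@tab_cell_blank t 0); last by left.
rewrite (@tab_cell_blank t j.+1); last by right; lia.
case: t q0 => [|t] q0; first by rewrite /tab_cell [first_row _ _ j.+1]first_row_end //; lia.
by rewrite !tab_cell_blank //; right; lia.
Qed.

End Halting.

(** * The prescribed first row and the guessed word *)

Definition blank_cell : pred letter := fun a => a == plain (tm_blank M).
Definition bit_cell (b : bool) : pred letter := fun a => a == inl (Some b).
Definition guess_cell : pred letter := fun a => if a is inl _ then true else false.
Definition end_cell : pred letter := fun a => a == inl None.

Definition first_row_preds (B m : nat) (x : seq bool) : seq (pred letter) :=
  nseq B blank_cell
  ++ flatten [seq [:: bit_cell b; bit_cell b] | b <- x]
  ++ [:: bit_cell false; bit_cell true]
  ++ nseq m guess_cell ++ nseq B end_cell ++ [:: blank_cell].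

Definition holds (gs : seq (pred letter)) (i : nat) (S : nat -> letter) : Prop :=
  forall j, j < size gs -> nth xpred0 gs j (S (i + j)).

Lemma holds_cat g1 g2 i S :
  holds (g1 ++ g2) i S <-> holds g1 i S /\ holds g2 (i + size g1) S.
Proof.
split=> [H|[H1 H2] j jl].
  split=> j jl; have := H.
    by move/(_ j); rewrite size_cat nth_cat jl; apply; rewrite ltn_addr.
  move/(_ (size g1 + j)); rewrite -addnA size_cat ltn_add2l nth_cat addKn.
  have -> : (size g1 + j < size g1) = false by lia.
  exact.
rewrite nth_cat; case: ltnP => [/H1 //|le].
rewrite size_cat in jl; have := H2 (j - size g1); rewrite -addnA subnKC //.
by apply; rewrite ltn_subLR.
Qed.

Lemma holds_nseq n g i S :
  holds (nseq n g) i S <-> forall j, j < n -> (g : pred letter) (S (i + j)).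
Proof.
by split=> H j; have := H j; rewrite size_nseq nth_nseq => Hj jn; move: (Hj jn); rewrite jn.
Qed.

Lemma holds_bits P i S : holds (map bit_cell P) i S <->
  forall j, j < size P -> S (i + j) = inl (onth P j).
Proof.
have E j : j < size P -> nth xpred0 (map bit_cell P) j = bit_cell (nth false P j).
  by move=> jP; rewrite (nth_map false).
have E' j : j < size P -> onth P j = Some (nth false P j).
  by move=> jP; rewrite onthE (nth_map false).
split=> H j jP; have := H j; rewrite size_map in jP *; rewrite E // E' // => /(_ jP).
  by move/eqP.
by move=> ->; apply/eqP.
Qed.

Lemma holds_first_row B m x S : let P := pair_bits x [::] in
  holds (first_row_preds B m x) 0 S <->
  [/\ forall j, j < B -> S j = plain (tm_blank M),
      forall j, j < size P -> S (B + j) = inl (onth P j),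
      forall j, j < m -> exists o, S (B + size P + j) = inl o,
      forall j, j < B -> S (B + size P + m + j) = inl None &
      S (B + size P + m + B) = plain (tm_blank M)].
Proof.
move=> P; have -> : first_row_preds B m x = nseq B blank_cell ++ map bit_cell P
    ++ nseq m guess_cell ++ nseq B end_cell ++ [:: blank_cell].
  rewrite /first_row_preds; congr (_ ++ _); rewrite /P /pair_bits cats0 map_cat -catA.
  by congr (_ ++ _); elim: x {P} => //= b x ->.
rewrite !holds_cat !holds_nseq holds_bits !size_nseq size_map !add0n.
split.
  move=> [H1 [H2 [H3 [H4 H5]]]]; split=> //.
  - by move=> j jB; apply/eqP; apply: H1.
  - by move=> j jm; have := H3 j jm; case: (S _) => // o _; exists o.
  - by move=> j jB; apply/eqP; apply: H4.
  - by have := H5 0 isT; rewrite addn0 => /eqP.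
move=> [H1 H2 H3 H4 H5]; split; last split=> //; last split; last split.
- by move=> j jB; apply/eqP; apply: H1.
- by move=> j jm; have [o ->] := H3 j jm.
- by move=> j jB; apply/eqP; apply: H4.
- by case=> // _; rewrite addn0; apply/eqP.
Qed.

Lemma size_first_row_preds B m x :
  size (first_row_preds B m x) = (B + size (pair_bits x [::]) + m + B).+1.
Proof.
have -> : size (pair_bits x [::]) = (size x).*2 + 2.
  by rewrite /pair_bits size_cat /=; congr (_ + _); elim: x => //= b x ->.
rewrite !size_cat /= !size_nseq.
have -> : size (flatten [seq [:: bit_cell b; bit_cell b] | b <- x]) = (size x).*2.
  by elim: x => //= b x ->.
lia.
Qed.

(** The word is what precedes the first end marker; a marker in front forces the rest of the stretch
    to be markers. *)
Lemma guessed_word m (s : nat -> letter) :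
  (forall j, j < m -> exists o, s j = inl o) ->
  (forall j, j.+1 < m -> ~~ input_after_end (s j) (s j.+1)) ->
  exists2 w, size w <= m & forall j, j < m -> s j = inl (onth w j).
Proof.
elim: m s => [|m IH] s Hs Hend; first by exists [::].
have [|j jm|w wm Hw] := IH (fun j => s j.+1).
- by move=> j jm; apply: Hs.
- exact: Hend.
have [[b|] s0] := Hs 0 isT.
  by exists (b :: w) => // -[|j] jm; [rewrite s0|rewrite Hw].
exists w; first exact: leqW.
suff w0 : w = [::].
  move=> [|j] jm; first by rewrite w0 s0.
  by rewrite Hw // w0 !onth0n.
case: w wm Hw => // b w wm Hw; have m0 : 0 < m := leq_ltn_trans (leq0n _) wm.
by have := Hend 0 m0; rewrite s0 Hw.
Qed.

Lemma halted_run_eq y t1 t2 : tm_halt M (run M t1 y).1 ->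
  tm_halt M (run M t2 y).1 -> run M t1 y = run M t2 y.
Proof.
by move=> h1 h2; case: (leqP t1 t2) => [|/ltnW] le; rewrite -(subnKC le) run_halted.
Qed.

(** * Tilings versus accepted witnesses *)

Section Verification.

Variables (B m : nat) (x : seq bool).
Hypothesis halts : forall w, size w <= m -> exists T,
  T + 3 <= B /\ tm_halt M (run M T (pair_bits x w)).1.

Let P := pair_bits x [::].
Let W := B + size P + m + B.
Let gs := first_row_preds B m x.

Definition accepts (y : seq bool) : Prop :=
  exists2 T, tm_halt M (run M T y).1 & tm_accept M (run M T y).1.

Lemma tiling_of_witness w : size w <= m -> accepts (pair_bits x w) ->
  exists S : nat -> letter, holds gs 0 S /\
    forall p, tile_ok (S p) (S p.+1) (S p.+2) (S (p + size gs)).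
Proof.
move=> wm [T' hT' aT']; have [T [TB hT]] := halts wm.
set y := pair_bits x w in hT hT' aT'.
have yE : y = P ++ w by rewrite /y /P /pair_bits cats0 -catA.
have y0 : y != [::] by rewrite /y /pair_bits -size_eq0 !size_cat /=; lia.
have yP : size y <= size P + m by rewrite yE size_cat leq_add2l.
have WB : B + maxn (size y) T.+1 + 2 <= W by rewrite /W; lia.
(* All halted configurations of a run coincide, so acceptance at one halting time gives it at
   all. *)
have accT t : tm_halt M (run M t y).1 -> tm_accept M (run M t y).1.
  by move=> ht; rewrite (halted_run_eq ht hT').
have row0E j : j < W -> tableau B y W j = first_row B y j.
  by move=> jW; rewrite -[j]add0n -(mul0n W) (tableauE y0 TB hT WB).
have rowE := tableauE y0 TB hT WB.
have row1E : tableau B y W W = plain (tm_blank M).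
  rewrite -[X in tableau _ _ _ X]addn0 -[X in X + 0]mul1n rowE; last by lia.
  by apply: (tab_cell_blank y0 TB hT); left.
exists (tableau B y W); split.
  apply/holds_first_row; split; last exact: row1E.
  - by move=> j jB; rewrite row0E /first_row ?jB // /W; lia.
  - move=> j jP; rewrite row0E /first_row; last by rewrite /W -/P in jP *; lia.
    by rewrite ltnNge leq_addr addKn yE onth_cat jP.
  - move=> j jm; rewrite row0E /first_row; last by rewrite /W -/P; lia.
    rewrite ltnNge -addnA leq_addr /=; by eexists.
  - move=> j jB; rewrite row0E -/P; last by rewrite /W; lia.
    by apply: first_row_end; lia.
have ends q : ~~ input_after_end (tableau B y W q) (tableau B y W q.+1).
  move: q; apply: (@div_ind W) => [|t j jW]; first by lia.
  rewrite rowE // -addnS.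
  case: t => [|t]; last by rewrite /tab_cell /letter_at; case: eqP.
  rewrite mul0n add0n /= /first_row; case: ltnP => // Bj.
  case Ej: (onth y (j - B)) => //.
  have [jW'|Wj] := ltnP j.+1 W; last first.
    have -> : j.+1 = W by lia.
    by rewrite row1E.
  rewrite row0E // first_row_end //.
  by move: (onthTE y (j - B)); rewrite Ej /=; lia.
have noreject q : ~~ rejecting (tableau B y W q).
  move: q; apply: (@div_ind W) => [|t j jW]; first by lia.
  rewrite rowE //.
  case: t => [|t]; first by rewrite /= /first_row; case: ltnP.
  rewrite /tab_cell /letter_at; case: eqP => //= _.
  by case E: (tm_halt M _) => //=; rewrite negbK accT.
move=> p; rewrite /tile_ok ends noreject !andbT.
by rewrite /gs size_first_row_preds (tableau_step y0 TB hT WB).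
Qed.

(** The witness is read from the free stretch; the windows then force [S] to be the tableau. Its
    head letter in row T + 1 is halted and not rejecting, hence accepting. *)
Lemma witness_of_tiling K S : B * size gs <= K -> holds gs 0 S ->
  (forall p, p < K -> tile_ok (S p) (S p.+1) (S p.+2) (S (p + size gs))) ->
  exists2 w, size w <= m & accepts (pair_bits x w).
Proof.
move=> BK /holds_first_row [H1 H2 H3 H4 H5] Sok.
have sgs : size gs = W.+1 by rewrite /gs size_first_row_preds.
have B3 : 3 <= B by have [T [TB _]] := @halts [::] (leq0n m); lia.
have KW : 3 * W.+1 <= K by apply: leq_trans BK; rewrite sgs leq_mul2r B3 orbT.
have Sstep p : p < K -> S (p + W.+1) = rule (S p) (S p.+1) (S p.+2).
  by move=> /Sok /and3P[/eqP + _ _]; rewrite sgs.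
have Send p : p < K -> ~~ input_after_end (S p.+1) (S p.+2).
  by move=> /Sok /and3P[].
have Srej p : p < K -> ~~ rejecting (S p.+1) by move=> /Sok /and3P[].
have [|j jm|w wm Hw] := @guessed_word m (fun j => S (B + size P + j)).
- exact: H3.
- have := Send (B + size P + j).-1; rewrite addnS prednK; last by lia.
  by apply; rewrite /W in KW; lia.
exists w => //; set y := pair_bits x w.
have [T [TB hT]] := halts wm; rewrite -/y in hT.
have yE : y = P ++ w by rewrite /y /P /pair_bits cats0 -catA.
have y0 : y != [::] by rewrite /y /pair_bits -size_eq0 !size_cat /=; lia.
have yP : size y <= size P + m by rewrite yE size_cat leq_add2l.
have WB : B + maxn (size y) T.+1 + 2 <= W by rewrite /W; lia.
have rowE := tableauE y0 TB hT WB.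
have row0 j : j < W -> S j = first_row B y j.
  move=> jW; rewrite /first_row; case: ltnP => [|Bj]; first exact: H1.
  rewrite -(subnKC Bj) addKn; set i := j - B.
  have iW : i < size P + m + B by rewrite /i /W in jW *; lia.
  case: (ltnP i (size P)) => [iP|Pi]; first by rewrite H2 // yE onth_cat iP.
  rewrite yE onth_cat ltnNge Pi /= -(subnKC Pi) addnA addKn.
  case: (ltnP (i - size P) m) => [im|mi]; first exact: Hw.
  rewrite onth_default; last by lia.
  by rewrite -(subnKC mi) addnA H4 //; lia.
have tabE i : i < W.+1 + K -> S i = tableau B y W i.
  elim/ltn_ind: i => i IH iK; case: (ltngtP i W) => [iW|Wi|->].
  - by rewrite row0 // -[i]add0n -(mul0n W) rowE.
  - have iE : i = (i - W.+1) + W.+1 by lia.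
    rewrite iE Sstep ?(tableau_step y0 TB hT WB) -?IH //; lia.
  - rewrite H5 -[X in tableau _ _ _ X]addn0 -[X in X + 0]mul1n rowE; last by lia.
    by rewrite (tab_cell_blank y0 TB hT) //; left.
exists T => //; have /andP[_ hB] := pos_bounds y0 TB hT T.
set h := pos B y T in hB.
(* The head letter of row T + 1 lies before (T + 2)W, and T + 2 <= [B]. *)
have iK : T.+1 * W + h <= K.
  apply: leq_trans BK; rewrite sgs; apply: leq_trans (_ : T.+2 * W <= _).
    by rewrite [T.+2 * W]mulSn addnC leq_add2r; lia.
  by apply: leq_mul; lia.
have := Srej (T.+1 * W + h).-1; rewrite prednK; last by rewrite mulSn; lia.
rewrite tabE; last by lia.
rewrite rowE; last by lia.
rewrite /tab_cell /letter_at -/h eqxx /= hT negbK; apply; rewrite mulSn in iK *; lia.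
Qed.

End Verification.

End Tableau.

Lemma size_pair_bits x w : size (pair_bits x w) = (size x).*2 + 2 + size w.
Proof.
rewrite /pair_bits !size_cat addnA; congr (_ + _ + _).
by elim: x => //= b x ->.
Qed.

Theorem theorem2 : NP_hard EQCAT_CONST_SAT.
Proof.
move=> L [V [c1 [k1 [[M [c2 [k2 decV]]] verL]]]].
pose x0 : letter M := inl None.
(* [c1], [k1] bound the witness, [c2], [k2] the running time of the verifier. *)
pose gs x := first_row_preds M (margin c1 k1 c2 k2 (size x)) (witlen c1 k1 (size x)) x.
pose red := reduction #|{: letter M}| (fun b => bad_cell x0 (@bit_cell M b))
  (bad_cell x0 (@blank_cell M)) (bad_cell x0 (@guess_cell M))
  (bad_cell x0 (@end_cell M)) (bad_empty (letter M))
  (bad_window x0 (@tile_ok M)) c1 k1 c2 k2.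
have redE x : red x =
    tiling_instance x0 (gs x) (@tile_ok M) (nwindows c1 k1 c2 k2 (size x)).
  have sz : size (gs x) = period c1 k1 c2 k2 (size x).
    by rewrite size_first_row_preds size_pair_bits /period /=; lia.
  rewrite /red /reduction /tiling_instance sz; congr (Instance _ (cells _ _ ++ _) _).
  rewrite /row0 /gs /first_row_preds !map_cat !map_nseq /=; congr (_ ++ (_ ++ _)).
  by elim: (x) => //= b x' ->.
exists (fun x => encode_instance (red x)); split; first exact: reduction_poly_computable.
move=> x; set n := size x; set m := witlen c1 k1 n; set B := margin c1 k1 c2 k2 n.
(* Monotonicity of [pbound] carries the time bound from each witness length to the largest one, on
   which the margin is based. *)
have decide w : size w <= m -> exists T, [/\ T + 3 <= B,
    tm_halt M (run M T (pair_bits x w)).1 &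
    (accepts M (pair_bits x w) <-> V (pair_bits x w))].
  move=> wm; have [T [TB [hT accT]]] := decV (pair_bits x w).
  exists T; split=> //.
    rewrite leq_add2r; apply: leq_trans TB _; apply: pbound_mono.
    by rewrite size_pair_bits leq_add2l.
  rewrite -accT; split=> [[T' hT' aT']|aT]; last by exists T.
  by rewrite (halted_run_eq hT hT').
have halts w : size w <= m ->
    exists T, T + 3 <= B /\ tm_halt M (run M T (pair_bits x w)).1.
  by move=> /decide[T [TB hT _]]; exists T.
have gs3 : 2 < size (gs x).
  by rewrite size_first_row_preds size_pair_bits /margin; lia.
have -> : EQCAT_CONST_SAT (encode_instance (red x)) <-> satisfiable (red x).
  split=> [[I [_ [/encode_instance_inj -> //]]]|sat]; exists (red x); split=> //.
  by rewrite redE; apply: tiling_wf.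
rewrite redE tiling_instanceP // verL; split.
  case=> w [wm Vw]; have [T [_ _ accV]] := decide w wm.
  have [S [Sgs Sok]] := tiling_of_witness halts wm (accV.2 Vw).
  by exists S; split=> // p _; apply: Sok.
case=> S [Sgs Sok]; have [|w wm acc] := @witness_of_tiling M B m x halts
   (nwindows c1 k1 c2 k2 n) S _ Sgs Sok.
  by rewrite leq_mul // size_first_row_preds size_pair_bits /period /=; lia.
have [T [_ _ accV]] := decide w wm.
by exists w; split=> //; apply/accV.
Qed.
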